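(* Let $\bar A=(A_0,A_1)$ be a compatible couple of (quasi-)Banach spaces with $A_0\cap A_1\neq\{0\}$. Let $0<\theta_0<\theta_1<1$, $0<q_0,r,r_1,r_0\le\infty$, $a,a_0,b_0,b_1\in SV$, and $\left\|s^{-1/r_0}\frac{b_0(s)}{a_0(s)}\right\|_{r_0,(0,1)}<\infty$. Put $c_0(t)=a_0(t)\left\|s^{-1/r_0}\frac{b_0(s)}{a_0(s)}\right\|_{r_0,(0,t)}$ and $\rho(t)=t^{\theta_1-\theta_0}\frac{c_0(t)}{b_1(t)}$ for $t>0$. (i) If $0<\theta<1$, then $$\left(\bar A^{\mathcal R}_{\theta_0,r_0,b_0,q_0,a_0},\bar A_{\theta_1,r_1,b_1}\right)_{\theta,r,a}\cong\bar A_{\eta,r,a^{\#}},$$ where $\eta=(1-\theta)\theta_0+\theta\theta_1$ and $a^{\#}(t)=c_0(t)^{1-\theta}b_1(t)^{\theta}a(\rho(t))$. (ii) If additionally $\left\|s^{-1/r}a(s)\right\|_{r,(0,1)}<\infty$, then $$\left(\bar A^{\mathcal R}_{\theta_0,r_0,b_0,q_0,a_0},\bar A_{\theta_1,r_1,b_1}\right)_{1,r,a}\cong\bar A^{\mathcal R}_{\theta_1,r,a^{\#},r_1,b_1},$$ where $a^{\#}(t)=b_1(t)a(\rho(t))$.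
   Context: For a compatible couple $\bar X=(X_0,X_1)$ of (quasi-)Banach spaces, $f\in X_0+X_1$ and $t>0$, $K(t,f)=K(t,f;\bar X)=\inf\{\|f_0\|_{X_0}+t\|f_1\|_{X_1}: f=f_0+f_1,\ f_i\in X_i\}$. $\|\cdot\|_{q,(c,d)}$ ($0<q\le\infty$) is the usual (quasi-)norm of the Lebesgue space $L_q$ on the interval $(c,d)$ with Lebesgue measure (variable of integration: the displayed variable; $1/\infty=0$). $SV$ is the set of positive Lebesgue measurable functions $b$ on $(0,\infty)$ that are slowly varying: for each $\varepsilon>0$, $t^{\varepsilon}b(t)$ is equivalent to an increasing function and $t^{-\varepsilon}b(t)$ is equivalent to a decreasing function, where two positive functions are equivalent if each is bounded by a constant multiple of the other. For $0\le\theta\le1$, $0<q\le\infty$, $b\in SV$, $\bar X_{\theta,q,b}=(X_0,X_1)_{\theta,q,b}$ is the space of $f\in X_0+X_1$ with $\|f\|=\left\|u^{-\theta-1/q}b(u)K(u,f)\right\|_{q,(0,\infty)}<\infty$. For $0<\sigma<1$, $0<r,q\le\infty$, $a,b\in SV$, $\bar X^{\mathcal R}_{\sigma,r,b,q,a}$ is the space of $f\in X_0+X_1$ with $\|f\|=\left\|t^{-1/r}\frac{b(t)}{a(t)}\left\|u^{-\sigma-1/q}a(u)K(u,f)\right\|_{q,(t,\infty)}\right\|_{r,(0,\infty)}<\infty$. $X\cong Y$ means that $X$ and $Y$ are continuously embedded in each other (same space, equivalent quasi-norms). *)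

(* Defs.v *)
From HB Require Import structures.
From mathcomp Require Import all_boot all_order all_algebra.
From mathcomp Require Import all_classical all_reals all_analysis.
From mathcomp Require Import measurable_realfun.

Set Implicit Arguments.
Unset Strict Implicit.
Unset Printing Implicit Defensive.

Import Order.TTheory GRing.Theory Num.Theory.
Import numFieldNormedType.Exports.

Local Open Scope classical_set_scope.
Local Open Scope ring_scope.

Section Lebesgue.
Context {R : realType}.

(* 1/q for 0 < q <= +oo, with 1/+oo = 0 *)
Definition rcp (q : \bar R) : R := fine (q^-1)%E.

(* The L_q (quasi-)norm on D; [Lnorm] at +oo is the essential supremum, which
   the extension of g by 0 outside D leaves unchanged when D has positive
   measure. *)
Definition Lq (q : \bar R) (D : set R) (g : R -> \bar R) : \bar R :=
  Lnorm (@lebesgue_measure R) q (g \_ D).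

(* Measurability for the Lebesgue (completed Borel) sigma-algebra on the
   source and the Borel sigma-algebra on the target. *)
Definition lebesgue_measurable_fun (D : set R) (b : R -> R) : Prop :=
  measurable_fun
    (D : set (g_sigma_algebraType (completed_algebra_gen (@lebesgue_measure R))))
    b.

Definition bounded_by_multiple (f g : R -> R) : Prop :=
  exists2 C : R, 0 < C & forall t, 0 < t -> f t <= C * g t.

Definition equiv_fun (f g : R -> R) : Prop :=
  bounded_by_multiple f g /\ bounded_by_multiple g f.

Definition positive_fun (b : R -> R) : Prop := forall t, 0 < t -> 0 < b t.

(* Only the values on ]0, +oo[ matter; monotonicity is non-strict. *)
Definition SV (b : R -> R) : Prop :=
  [/\ positive_fun b,
      lebesgue_measurable_fun `]0, +oo[ b
    & forall e : R, 0 < e ->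
      (exists g : R -> R, [/\ positive_fun g,
          (forall s t, 0 < s -> s <= t -> g s <= g t)
        & equiv_fun (fun t => t `^ e * b t) g]) /\
      (exists g : R -> R, [/\ positive_fun g,
          (forall s t, 0 < s -> s <= t -> g t <= g s)
        & equiv_fun (fun t => t `^ (- e) * b t) g])].

End Lebesgue.

Section Couples.
Context {R : realType} {V : topologicalLmodType R}.

(* Candidate quasi-normed spaces inside V; [qnorm] is meaningful only on
   [carrier], where the axioms below require it to be finite. *)
Record qspace := QSpace { carrier : set V; qnorm : V -> \bar R }.

Implicit Types (X Y : qspace) (f : V).

Definition quasi_normed X : Prop :=
  [/\ carrier X 0,
      forall (k : R) x y, carrier X x -> carrier X y -> carrier X (k *: x + y),
      forall x, carrier X x ->
        (0 <= qnorm X x < +oo)%E /\ (qnorm X x = 0%E <-> x = 0),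
      forall (k : R) x, carrier X x -> qnorm X (k *: x) = (`|k|%:E * qnorm X x)%E
    & exists2 C : R, 1 <= C & forall x y, carrier X x -> carrier X y ->
        (qnorm X (x + y)%R <= C%:E * (qnorm X x + qnorm X y))%E].

Definition quasi_complete X : Prop :=
  forall u : nat -> V, (forall n, carrier X (u n)) ->
    (forall e : R, 0 < e ->
      \forall m \near \oo & n \near \oo, (qnorm X (u m - u n)%R < e%:E)%E) ->
    exists2 x, carrier X x & qnorm X (u n - x) @[n --> \oo] --> 0%E.

Definition quasi_banach X : Prop := quasi_normed X /\ quasi_complete X.

Definition embedded_in_ambient X : Prop :=
  forall U : set V, nbhs 0 U -> exists2 d : R, 0 < d &
    forall x, carrier X x -> (qnorm X x < d%:E)%E -> U x.

(* Scalars are real; complex spaces are covered by restriction of scalars,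
   which changes neither K nor any of the norms. *)
Definition compatible_couple (X0 X1 : qspace) : Prop :=
  [/\ hausdorff_space V,
      quasi_banach X0 /\ quasi_banach X1
    & embedded_in_ambient X0 /\ embedded_in_ambient X1].

Definition sum_space (X0 X1 : qspace) : set V :=
  [set f | exists f0 f1, [/\ carrier X0 f0, carrier X1 f1 & f = f0 + f1]].

Definition Kfun (X0 X1 : qspace) (t : R) f : \bar R :=
  ereal_inf [set y | exists f0 f1,
    [/\ carrier X0 f0, carrier X1 f1, f = f0 + f1
      & y = (qnorm X0 f0 + t%:E * qnorm X1 f1)%E]].

Definition interp_norm (X0 X1 : qspace) (theta : R) (q : \bar R) (b : R -> R) f :
    \bar R :=
  Lq q `]0, +oo[
    (fun u => (u `^ (- theta - rcp q) * b u)%:E * Kfun X0 X1 u f)%E.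

Definition interp (X0 X1 : qspace) theta q b : qspace :=
  QSpace [set f | sum_space X0 X1 f /\ (interp_norm X0 X1 theta q b f < +oo)%E]
         (interp_norm X0 X1 theta q b).

Definition interpR_norm (X0 X1 : qspace) (sigma : R) (r : \bar R) (b : R -> R)
    (q : \bar R) (a : R -> R) f : \bar R :=
  Lq r `]0, +oo[
    (fun t => (t `^ (- rcp r) * (b t / a t))%:E *
      Lq q `]t, +oo[
        (fun u => (u `^ (- sigma - rcp q) * a u)%:E * Kfun X0 X1 u f))%E.

Definition interpR (X0 X1 : qspace) sigma r b q a : qspace :=
  QSpace
    [set f | sum_space X0 X1 f /\ (interpR_norm X0 X1 sigma r b q a f < +oo)%E]
    (interpR_norm X0 X1 sigma r b q a).

Definition embedded X Y : Prop :=
  carrier X `<=` carrier Y /\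
  exists2 C : R, 0 < C &
    forall f, carrier X f -> (qnorm Y f <= C%:E * qnorm X f)%E.

Definition cong_space X Y : Prop := embedded X Y /\ embedded Y X.

End Couples.

Arguments qspace {R} V.

(* Main.v *)
Require Import Defs.
From HB Require Import structures.
From mathcomp Require Import all_boot all_order all_algebra.
From mathcomp Require Import all_classical all_reals all_analysis.
From mathcomp Require Import measurable_realfun ess_sup_inf ring lra.

(* Only the Holmstedt-type estimates
     c rho(t) Q(t, f) <= K(rho(t), f) <= C (M + rho(t) Q(t, f))
   are needed, where K is the K-functional of the couple of the theorem,
   Q(t, f) = ||u^(-theta1-1/r1) b1(u) K(u, f; A)||_{r1,(t,oo)}, and M is any bound
   such that N(u) = u^(-theta0) c0(u) K(u, f; A) satisfies N(u) <= (u/t)^eps M for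
   u <= t; the customary nested norm over (0,t) in the upper estimate is dominated
   by the best such M.  Since N <= rho Q, the weighted norm of M is controlled by
   the one of rho Q by a Hardy inequality, and if theta < 1 then conversely rho Q
   is controlled by N.
   All integrals are replaced by sums over the intervals ]e^j, e^(j+1)], j in Z, on
   which the integrands are constant up to a factor.  The Hardy inequalities and
   the substitution u = rho(t) then become instances of a Schur test with kernel
   exp(-e |j - m(k)|), valid for all exponents 0 < q <= oo. *)
Set Implicit Arguments.
Unset Strict Implicit.
Unset Printing Implicit Defensive.

Import Order.TTheory GRing.Theory Num.Theory.
Import numFieldNormedType.Exports.

Local Open Scope classical_set_scope.
Local Open Scope ring_scope.

(** * Sequence norms over the integers *)

Section DiscreteLebesgue.
Context {R : realType}.
Implicit Types (q : \bar R) (x y : int -> \bar R).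
Local Open Scope ereal_scope.

(** A function in [SV] is only equivalent to monotone ones, so rho need be neither monotone nor
    continuous, and u = rho(t) is no honest substitution: in the variable ln t all that is known is
    that ln rho increases with slope between two positive constants, up to a bounded error.
    Composites such as a(rho(t)) need not be measurable either; integrals are therefore compared as
    suprema over simple functions. Exponents below 1 admit no triangle inequality, which is why the
    kernel of the Schur test stands under a supremum instead of a sum. A slowly varying factor costs
    e^(e|y - x|) with e as small as desired. In the estimates a strict gap pays for it: theta0 > 0,
    theta1 < 1 and theta1 > theta0 for the bounds on K, theta > 0 for the Hardy inequality, theta <
    1 for its converse. The last gap closes at theta = 1; this is why the space in (ii) keeps the
    nested norm over (t,oo), while in (i) it collapses to a plain weight. *)

Lemma le_poweR (r : R) (u v : \bar R) : (0 <= r)%R -> 0 <= u -> u <= v ->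
  u `^ r <= v `^ r.
Proof.
move=> r0 u0 uv; apply: gt0_ler_poweR => //; rewrite in_itv /= ?u0 ?leey//.
by rewrite (le_trans u0 uv).
Qed.

Lemma poweRK (r : R) (u : \bar R) : (0 < r)%R -> 0 <= u ->
  (u `^ r) `^ r^-1 = u.
Proof. by move=> r0 u0; rewrite -poweRrM mulfV ?gt_eqF// poweRe1. Qed.

Lemma poweRVK (r : R) (u : \bar R) : (0 < r)%R -> 0 <= u ->
  (u `^ r^-1) `^ r = u.
Proof. by move=> r0 u0; rewrite -poweRrM mulVf ?gt_eqF// poweRe1. Qed.

Lemma esumZl (T : choiceType) (c : R) (a : T -> \bar R) : (0 < c)%R ->
  (forall i, 0 <= a i) ->
  \esum_(i in [set: T]) (c%:E * a i) = c%:E * \esum_(i in [set: T]) a i.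
Proof.
move=> c0 a0; rewrite /esum -ereal_sup_pZl//; congr ereal_sup.
rewrite image_comp; apply/seteqP; split => _ [X hX <-]; exists X => //=;
  by rewrite ge0_mule_fsumr.
Qed.

Lemma esum_int (a : int -> \bar R) : (forall j, 0 <= a j) ->
  \esum_(j in [set: int]) a j =
  \sum_(n <oo) a (Posz n) + \sum_(n <oo) a (Negz n).
Proof.
move=> a0; rewrite (esumID (range Posz))// !setTI; congr (_ + _).
  by rewrite esum_image ?nneseries_esumT// => m n _ _ [].
rewrite (_ : ~` _ = range Negz); last first.
  apply/seteqP; split => [[n|n] /=|_ [n _ <-] [m _]//].
  - by case; exists n.
  - by exists n.
by rewrite esum_image ?nneseries_esumT// => m n _ _ [].
Qed.

Lemma esum_geometric (e : R) : (0 < e)%R -> exists2 D : R, (0 < D)%R &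
  forall m : int, \esum_(j in [set: int])
    (expR (- e * `|j%:~R - m%:~R|))%:E <= D%:E.
Proof.
move=> e0; pose z := expR (- e).
have z1 : (z < 1)%R by rewrite expR_lt1 oppr_lt0.
have z0 : (0 < z)%R := expR_gt0 _.
have s0 : (0 < 1 / (1 - z))%R by rewrite divr_gt0// subr_gt0.
have zn (n : nat) : expR (- e * n%:R) = geometric 1 z n.
  by rewrite expRM_natr /geometric /= mul1r.
have zle (u : nat -> \bar R) : (forall n, 0 <= u n <= (geometric 1 z n)%:E) ->
    \sum_(n <oo) u n <= (1 / (1 - z))%:E.
  move=> hu; apply: lime_le.
    by apply: is_cvg_nneseries => n _ _; case/andP: (hu n).
  apply: nearW => n; apply: (@le_trans _ _ (series (geometric 1 z) n)%:E).
    rewrite /series /= -sumEFin; apply: lee_sum => i _.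
    by case/andP: (hu i).
  by rewrite lee_fin geometric_le_lim// ger0_norm// ltW.
exists (1 / (1 - z) + 1 / (1 - z))%R; first exact: addr_gt0.
move=> m; rewrite (reindex_esum setT setT (fun j => (j + m)%R)); last first.
  split=> [//|i j _ _ /addIr//|j _]; by exists (j - m)%R => //; rewrite subrK.
rewrite (eq_esum (b := fun j : int => (expR (- e * `|j%:~R|))%:E)); last first.
  by move=> j _; rewrite intrD addrK.
rewrite esum_int => [|j]; last by rewrite lee_fin expR_ge0.
rewrite EFinD; apply: leeD; apply: zle => n; rewrite lee_fin expR_ge0 lee_fin.
  by rewrite -zn/= ger0_norm.
(* [Negz n] is [-(n + 1)], so this half is dominated by the same series with a factor [z] to
   spare. *)
rewrite -zn/= ler_expR NegzE mulrNz normrN ger0_norm// !mulNr lerN2.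
by rewrite ler_pM2l//= pmulrn ler_nat.
Qed.

(** The wildcard is meant for [+oo]; [-oo] also falls there and is excluded by [0 < q] wherever it
    matters. *)
Definition lq q x : \bar R :=
  match q with
  | r%:E => (\esum_(j in [set: int]) (x j `^ r)) `^ r^-1
  | _ => ereal_sup (range x)
  end.

Lemma lq_ge_term q x j : 0 < q -> (forall i, 0 <= x i) -> x j <= lq q x.
Proof.
case: q => [r| |]//=; [rewrite lte_fin => r0 x0|move=> _ _]; last first.
  by apply: ereal_sup_ubound; exists j.
rewrite -[leLHS](poweRK r0)//; apply: le_poweR; rewrite ?invr_ge0 ?poweR_ge0 ?(ltW r0)//.
apply: esum_ge; exists [set j]; last by rewrite fsbig_set1.
by split => //; exact: finite_set1.
Qed.

Lemma lq_ge0 q x : 0 < q -> (forall i, 0 <= x i) -> 0 <= lq q x.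
Proof. by move=> q0 x0; rewrite (le_trans (x0 0%R)) ?lq_ge_term. Qed.

Lemma lq_le q x y : 0 < q -> (forall j, 0 <= x j) ->
  (forall j, x j <= y j) -> lq q x <= lq q y.
Proof.
case: q => [r| |]//=; [rewrite lte_fin => r0 x0 xy|move=> _ _ xy]; last first.
  apply: ge_ereal_sup => _ [j _ <-]; apply: le_trans (xy j) _.
  by apply: ereal_sup_ubound; exists j.
apply: le_poweR; first by rewrite invr_ge0 ltW.
  by apply: esum_ge0 => j _; exact: poweR_ge0.
by apply: le_esum => j _; apply: le_poweR => //; exact: ltW.
Qed.

Lemma lqZ q x (c : R) : 0 < q -> (0 < c)%R -> (forall j, 0 <= x j) ->
  lq q (fun j => c%:E * x j) = c%:E * lq q x.
Proof.
case: q => [r| |]//=; [rewrite lte_fin => r0 c0 x0|move=> _ c0 x0]; last first.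
  by rewrite -ereal_sup_pZl// image_comp.
under eq_esum do rewrite poweRM ?lee_fin ?(ltW c0)//=.
rewrite esumZl ?powR_gt0// => [|i]; last exact: poweR_ge0.
rewrite poweRM ?lee_fin ?powR_ge0//.
  by rewrite -[X in X `^ r^-1 * _ = _]/(c%:E `^ r) poweRK// lee_fin ltW.
by apply: esum_ge0 => j _; exact: poweR_ge0.
Qed.

(** Bounding [u + v] by twice the larger term treats [r < 1] and [r > 1] alike, without
    convexity. *)
Lemma poweR_maxD (r : R) (u v : \bar R) : (0 < r)%R -> 0 <= u -> 0 <= v ->
  (u + v) `^ r <= ((2 `^ r)%R)%:E * (u `^ r + v `^ r).
Proof.
move=> r0 u0 v0.
have h w : 0 <= w -> u <= w -> v <= w ->
    (u + v) `^ r <= ((2 `^ r)%R)%:E * w `^ r.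
  move=> w0 uw vw.
  rewrite -[X in X * _]/(2%:E `^ r) -poweRM ?lee_fin//.
  apply: le_poweR; [exact: ltW|exact: adde_ge0|].
  by rewrite mule_natl mule2n leeD.
have k0 : 0 <= ((2 `^ r)%R)%:E :> \bar R by rewrite lee_fin powR_ge0.
have [uv|/ltW vu] := leP u v.
  apply: le_trans (h v v0 uv (lexx _)) _; apply: lee_wpmul2l => //.
  by rewrite leeDr ?poweR_ge0.
apply: le_trans (h u u0 (lexx _) vu) _; apply: lee_wpmul2l => //.
by rewrite leeDl ?poweR_ge0.
Qed.

(** [poweR_maxD] is used twice: with exponent [r] termwise, then with [r^-1] on the two sums. This
    gives the constant 2 * 2^(1/r). *)
Lemma lqD q : 0 < q -> exists2 C : R, (0 < C)%R &
  forall x y, (forall j, 0 <= x j) -> (forall j, 0 <= y j) ->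
  lq q (fun j => x j + y j) <= C%:E * (lq q x + lq q y).
Proof.
case: q => [r| |]//=; [rewrite lte_fin => r0|move=> _]; last first.
  exists 1%R => // x y x0 y0; rewrite mul1e.
  apply: ge_ereal_sup => _ [j _ <-].
  by apply: leeD; apply: ereal_sup_ubound; exists j.
have ri0 : (0 < r^-1)%R by rewrite invr_gt0.
exists (2 * 2 `^ r^-1)%R; first by rewrite mulr_gt0// powR_gt0.
move=> x y x0 y0; set a := esum _ (fun j => x j `^ r).
set b := esum _ (fun j => y j `^ r).
have a0 : 0 <= a by apply: esum_ge0 => j _; exact: poweR_ge0.
have b0 : 0 <= b by apply: esum_ge0 => j _; exact: poweR_ge0.
have -> : ((2 * 2 `^ r^-1)%R)%:E = ((2 `^ r)%R)%:E `^ r^-1 * (2 `^ r^-1)%:E.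
  by rewrite EFinM -[(2 `^ r)%:E]/(2%:E `^ r) poweRK.
rewrite -muleA; apply: (@le_trans _ _ ((((2 `^ r)%R)%:E * (a + b)) `^ r^-1)).
  apply: le_poweR; [exact: ltW|by apply: esum_ge0 => j _; exact: poweR_ge0|].
  rewrite /a /b -esumD => [|j _|j _]; try exact: poweR_ge0.
  rewrite -esumZl ?powR_gt0// => [|j]; last by rewrite adde_ge0 ?poweR_ge0.
  by apply: le_esum => j _; exact: poweR_maxD.
rewrite poweRM ?lee_fin ?powR_ge0 ?adde_ge0//.
apply: lee_wpmul2l; first exact: poweR_ge0.
exact: poweR_maxD.
Qed.

(* [m] is arbitrary: only the column sums of the kernel have to be bounded. *)
Lemma lq_schur q (e : R) : 0 < q -> (0 < e)%R -> exists2 D : R, (0 < D)%R &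
  forall x y (m : int -> int), (forall j, 0 <= x j) -> (forall j, 0 <= y j) ->
  (forall j, x j <= ereal_sup
     [set (expR (- e * `|j%:~R - (m k)%:~R|))%:E * y k | k in setT]) ->
  lq q x <= D%:E * lq q y.
Proof.
case: q => [r| |]//=; [rewrite lte_fin => r0 e0|move=> _ e0]; last first.
  exists 1%R => // x y m x0 y0 xy; rewrite mul1e.
  apply: ge_ereal_sup => _ [j _ <-]; apply: le_trans (xy j) _.
  apply: ge_ereal_sup => _ [k _ <-].
  apply: (@le_trans _ _ (y k)); last by apply: ereal_sup_ubound; exists k.
  rewrite -[leRHS]mul1e; apply: lee_wpmul2r => //.
  by rewrite lee_fin expR_le1 mulNr oppr_le0 mulr_ge0// ltW.
(* The r-th power of a supremum is at most the sum of the r-th powers, for every [r > 0]; the kernel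
   then decays at rate [e * r]. *)
have [D D0 hD] := esum_geometric (mulr_gt0 e0 r0).
have ri0 : (0 < r^-1)%R by rewrite invr_gt0.
exists (D `^ r^-1)%R; first exact: powR_gt0.
move=> x y m x0 y0 xy.
have yr0 k : 0 <= y k `^ r by exact: poweR_ge0.
rewrite -[(D `^ r^-1)%:E]/(D%:E `^ r^-1) -poweRM ?lee_fin ?(ltW D0)//; last first.
  exact: esum_ge0.
apply: le_poweR; [exact: ltW|by apply: esum_ge0 => j _; exact: poweR_ge0|].
pose G (j k : int) := (expR (- (e * r) * `|j%:~R - (m k)%:~R|))%:E * y k `^ r.
have G0 j k : 0 <= G j k by rewrite mule_ge0// lee_fin expR_ge0.
have hx j : x j `^ r <= \esum_(k in [set: int]) G j k.
  rewrite -[leRHS](poweRVK r0) ?esum_ge0//; apply: le_poweR => //; first exact: ltW.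
  apply: le_trans (xy j) _; apply: ge_ereal_sup => _ [k _ <-].
  rewrite -[leLHS](poweRK r0); last by rewrite mule_ge0// lee_fin expR_ge0.
  apply: le_poweR; [exact: ltW|exact: poweR_ge0|].
  apply: esum_ge; exists [set k]; first by split => //; exact: finite_set1.
  rewrite fsbig_set1 /G poweRM ?lee_fin ?expR_ge0//=.
  rewrite -expRM le_eqVlt; apply/orP; left; apply/eqP.
  by congr ((expR _)%:E * _); ring.
apply: (@le_trans _ _ (\esum_(j in [set: int]) \esum_(k in [set: int]) G j k)).
  by apply: le_esum => j _.
(* Tonelli: for fixed [k] the sum over [j] is a two-sided geometric sum centred at [m k], bounded by
   [D] wherever that centre lies. *)
rewrite esum_esum// (reindex_esum (setT `*`` (fun=> setT)) _
  (fun z : int * int => (z.2, z.1))); last first.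
  split => //; first by move=> [a b] [c d] _ _ [-> ->].
  by move=> [a b] _; exists (b, a).
rewrite -(@esum_esum _ _ _ _ (fun=> setT) (fun k j => G j k))//.
rewrite -esumZl//; apply: le_esum => k _; rewrite /G.
case: (y k `^ r) (yr0 k) => [c c0|_|//]; last by rewrite gt0_muley ?leey.
move: c0; rewrite lee_fin le_eqVlt => /predU1P[<-|c0].
  by rewrite mule0 esum1// => j _; rewrite mule0.
under eq_esum do rewrite muleC.
rewrite esumZl; [|exact: c0|by move=> j; rewrite lee_fin expR_ge0].
by rewrite muleC; apply: lee_wpmul2r; [rewrite lee_fin ltW|exact: hD].
Qed.

Lemma lq_schur_id q (e C : R) : 0 < q -> (0 < e)%R -> (0 < C)%R ->
  exists2 D : R, (0 < D)%R & forall x y,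
  (forall j, 0 <= x j) -> (forall j, 0 <= y j) ->
  (forall j, exists k, x j <= (C * expR (- e * `|j%:~R - k%:~R|))%:E * y k) ->
  lq q x <= D%:E * lq q y.
Proof.
move=> q0 e0 C0; have [D D0 hD] := lq_schur q0 e0.
exists (D * C)%R; first exact: mulr_gt0.
move=> x y x0 y0 xy; rewrite EFinM -muleA -lqZ//.
apply: (hD x (fun k => C%:E * y k) id) => // [j|j].
  by rewrite mule_ge0// lee_fin ltW.
have [k xk] := xy j; apply: le_ereal_sup_tmp.
eexists; first by exists k.
by apply: le_trans xk _; rewrite [(C * _)%R]mulrC EFinM muleA.
Qed.

(** The shift is absorbed into the map [m] of the Schur test, which makes [D] independent of [s].
    This uniformity is what allows shifts of arbitrary length below. *)
Lemma lq_shift q : 0 < q -> exists2 D : R, (0 < D)%R & forall (s : int) x y,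
  (forall j, 0 <= x j) -> (forall j, 0 <= y j) ->
  (forall j, x j <= y (j - s)%R) -> lq q x <= D%:E * lq q y.
Proof.
move=> q0; have [D D0 hD] := @lq_schur q 1 q0 ltr01.
exists D => // s x y x0 y0 xy; apply: (hD x y (fun k => k + s)%R) => // j.
apply: le_ereal_sup_tmp; eexists; first by exists (j - s)%R.
by rewrite subrK subrr normr0 mulr0 expR0 mul1e.
Qed.

(** Schur test with [m] constantly equal to [k], against the sequence that carries [M] at one index
    and vanishes elsewhere. *)
Lemma lq_bump q (e : R) : 0 < q -> (0 < e)%R -> exists2 D : R, (0 < D)%R &
  forall x (M : \bar R) (k : int), (forall j, 0 <= x j) -> 0 <= M ->
  (forall j, x j <= (expR (- e * `|j%:~R - k%:~R|))%:E * M) ->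
  lq q x <= D%:E * M.
Proof.
move=> q0 e0; have [D D0 hD] := lq_schur q0 e0.
exists D => // x M k x0 M0 xM; pose y (j : int) := if j == Posz 0 then M else 0.
have y0 j : 0 <= y j by rewrite /y; case: ifP.
apply: le_trans (hD x y (fun=> k) x0 y0 _) _ => [j|].
  apply: le_ereal_sup_tmp; eexists; first by exists (Posz 0).
  by rewrite /y eqxx.
apply: lee_wpmul2l; first by rewrite lee_fin ltW.
case: q q0 {hD} => [r| |]//=; [rewrite lte_fin => r0|move=> _]; last first.
  by apply: ge_ereal_sup => _ [j _ <-]; rewrite /y; case: ifP.
rewrite -[leRHS](poweRK r0)//; apply: le_poweR.
- by rewrite invr_ge0 ltW.
- by apply: esum_ge0 => j _; exact: poweR_ge0.
rewrite (_ : esum _ _ = \esum_(j in [set Posz 0]) y j `^ r).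
  by rewrite esum_set1 ?poweR_ge0// /y eqxx.
rewrite [RHS]esum_mkcond; apply: eq_esum => j _.
have [->|j0] := eqVneq j (Posz 0); first by rewrite mem_set.
by rewrite memNset ?/y ?(negbTE j0) ?poweR0r ?gt_eqF//; exact/eqP.
Qed.

End DiscreteLebesgue.

(** * Lebesgue norms over exponential intervals *)

Section Discretization.
Context {R : realType}.
Implicit Types (q : \bar R) (x y : int -> \bar R) (u : R).

Definition dyad (j : int) : set R := `]expR j%:~R, expR (j%:~R + 1)]%classic.

(** The intervals are open on the left and closed on the right, hence the ceiling minus one instead
    of the floor. *)
Definition dyadic_index u : int := Num.ceil (ln u) - 1.

Lemma dyadP j u :
  dyad j u <-> 0 < u /\ j%:~R < ln u <= j%:~R + 1.
Proof.
rewrite /dyad/= in_itv/=; split.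
  move=> /andP[ju uj]; have u0 : 0 < u := lt_trans (expR_gt0 _) ju.
  split=> //; apply/andP; split.
    by rewrite -ltr_expR lnK.
  by rewrite -ler_expR lnK.
move=> [u0 /andP[ju uj]]; apply/andP; split.
  by rewrite -[ltRHS]lnK// ltr_expR.
by rewrite -[leLHS]lnK// ler_expR.
Qed.

Lemma dyadic_indexP u : 0 < u -> dyad (dyadic_index u) u.
Proof.
move=> u0; apply/dyadP; split => //; rewrite /dyadic_index intrB.
by have /andP[] := ceil_itv (ln u); rewrite subrK intrB => -> ->.
Qed.

Lemma dyad_inj i j u : dyad i u -> dyad j u -> i = j.
Proof.
move=> /dyadP[_ /andP[i1 i2]] /dyadP[_ /andP[j1 j2]].
have h (a b : int) : a%:~R < ln u -> ln u <= b%:~R + 1 -> a <= b.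
  move=> h1 h2; have := lt_le_trans h1 h2.
  by rewrite -[1]/(1%:~R) -intrD ltr_int ltzD1.
by apply/eqP; rewrite eq_le !h.
Qed.

Lemma measurable_dyad j : measurable (dyad j).
Proof. exact: measurable_itv. Qed.

Lemma lebesgue_measure_dyad j :
  lebesgue_measure (dyad j) = (expR j%:~R * (expR 1 - 1))%:E.
Proof.
rewrite lebesgue_measure_itv/= lte_fin ltr_expR ltrDl ltr01 EFinN -EFinB.
by rewrite expRD mulrBr mulr1.
Qed.

Local Open Scope ereal_scope.

(* No measurability: the integral of a nonnegative function is a supremum over
   the simple functions below it. *)
Lemma ge0_le_integral_lower (f g : R -> \bar R) :
  (forall u, 0 <= f u) -> (forall u, f u <= g u) ->
  \int[lebesgue_measure]_u f u <= \int[lebesgue_measure]_u g u.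
Proof.
move=> f0 fg; rewrite !ge0_integralTE//; last first.
  by move=> u; exact: le_trans (f0 u) (fg u).
apply: ge_ereal_sup => _ [h hf <-]; apply: ereal_sup_ubound.
by exists h => // u; exact: le_trans (hf u) (fg u).
Qed.

Let step (c : int -> \bar R) (j : int) : R -> \bar R := cst (c j) \_ (dyad j).

Let step_ge0 c j u : (forall i, 0 <= c i) -> 0 <= step c j u.
Proof. by move=> c0; rewrite /step patchE; case: ifP => _ /=; rewrite ?c0. Qed.

Let measurable_step c j : measurable_fun setT (step c j).
Proof.
by apply/(measurable_restrictT _ (measurable_dyad j)); exact: measurable_cst.
Qed.

Let integral_step c j : \int[lebesgue_measure]_u step c j u =
  c j * lebesgue_measure (dyad j).
Proof. by rewrite -integral_mkcond integral_cst//; exact: measurable_dyad. Qed.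

Let step_out c j i u : dyad i u -> j != i -> step c j u = 0.
Proof.
move=> iu ji; rewrite /step patchE memNset// => ju.
by move/eqP: ji; apply; exact: dyad_inj ju iu.
Qed.

Let step_in c i u : dyad i u -> step c i u = c i.
Proof. by move=> iu; rewrite /step patchE mem_set. Qed.

(** Only the step functions have to be measurable: their sum is integrated term by term, and [f] is
    compared with it pointwise. *)
Lemma integral_le_esum_dyad (f : R -> \bar R) (c : int -> \bar R) :
  (forall j, 0 <= c j) -> (forall u, 0 <= f u) ->
  (forall u, (u <= 0)%R -> f u = 0) ->
  (forall j u, dyad j u -> f u <= c j) ->
  \int[lebesgue_measure]_u f u <=
  \esum_(j in [set: int]) (c j * lebesgue_measure (dyad j)).
Proof.
move=> c0 f0 fneg fc.
rewrite esum_int => [|j]; last by rewrite mule_ge0.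
rewrite -nneseriesD => [|n _ _|n _ _]; try by rewrite mule_ge0.
(* [Posz n] and [Negz n] are paired, so that the sum over the integers becomes a series of functions
   indexed by [nat]. *)
pose h (n : nat) u := step c (Posz n) u + step c (Negz n) u.
have h0 n u : 0 <= h n u by rewrite adde_ge0 ?step_ge0.
apply: (@le_trans _ _ (\int[lebesgue_measure]_u \sum_(n <oo) h n u)); last first.
  rewrite integral_nneseries//; last first.
    by move=> n; apply: emeasurable_funD; exact: measurable_step.
  apply: lee_nneseries => [n _ _|n _]; first exact: integral_ge0.
  rewrite ge0_integralD => //; try (by move=> u _; exact: step_ge0);
    try exact: measurable_step.
  by rewrite !integral_step.
apply: ge0_le_integral_lower => // u.
have [u0|u0] := leP u 0%R; first by rewrite fneg// nneseries_ge0.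
have ju := dyadic_indexP u0; apply: le_trans (fc _ _ ju) _.
have [n hn] : exists n, c (dyadic_index u) <= h n u.
  case: (dyadic_index u) ju => n ju; exists n; rewrite /h.
    by rewrite step_in// leeDl ?step_ge0.
  by rewrite [X in _ + X]step_in// leeDr ?step_ge0.
apply: le_trans hn _; rewrite (@nneseriesD1 _ _ n)//.
by rewrite leeDl// nneseries_ge0.
Qed.

(** A finite partial sum is the integral of finitely many disjoint steps lying below [f]; the full
    sum is the supremum of these. *)
Lemma esum_dyad_le_integral (f : R -> \bar R) (c : int -> \bar R) :
  (forall j, 0 <= c j) -> (forall u, 0 <= f u) ->
  (forall j u, dyad j u -> c j <= f u) ->
  \esum_(j in [set: int]) (c j * lebesgue_measure (dyad j)) <=
  \int[lebesgue_measure]_u f u.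
Proof.
move=> c0 f0 cf; apply: ge_ereal_sup => _ [F [finF _] <-].
have := @ge0_integral_fsum _ _ _ (@lebesgue_measure R) setT measurableT _
  (step c) (measurable_step c) (fun j u _ => step_ge0 j u c0) F finF.
under [in X in _ = X -> _]eq_fsbigr do rewrite integral_step.
move=> <-; apply: ge0_le_integral_lower => u.
  by rewrite fsume_ge0// => j _; exact: step_ge0.
rewrite fsbig_finite//=.
have [u0|u0] := leP u 0%R.
  rewrite big1// => j _; rewrite /step patchE memNset// => /dyadP[].
  by rewrite ltNge u0.
have ju := dyadic_indexP u0.
have [js|js] := boolP (dyadic_index u \in finmap.enum_fset (fset_set F)).
  rewrite (bigD1_seq _ js) ?finmap.fset_uniq//= big1 => [|j ji].
    by rewrite adde0 step_in//; exact: cf.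
  exact: step_out ju ji.
rewrite big_seq big1// => j jF; apply: step_out ju _.
by apply: contraNneq js => <-.
Qed.

Lemma rcp_fin (r : R) : (0 < r)%R -> rcp r%:E = (r^-1)%R.
Proof. by move=> r0; rewrite /rcp inver gt_eqF. Qed.

Lemma rcp_pinfty : rcp +oo = 0%R :> R.
Proof. by rewrite /rcp invey. Qed.

Let expR1B1_gt0 : (0 < expR 1 - 1 :> R)%R.
Proof. by rewrite subr_gt0 expR_gt1. Qed.

(** The factor u^(-1/q) turns du into du/u: its q-th power is at most e^(-j) on the interval of
    index [j], which cancels the length e^j (e - 1) up to the factor e - 1. *)
Lemma Lq_le_lq q : 0 < q -> exists2 C : R, (0 < C)%R &
  forall (D : set R) (g : R -> \bar R) x, (forall j, 0 <= x j) ->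
  (forall u, D u -> (0 < u)%R) ->
  (forall j u, dyad j u -> D u -> `|g u| <= (u `^ (- rcp q))%:E * x j) ->
  Lq q D g <= C%:E * lq q x.
Proof.
case: q => [r| |]//; [rewrite lte_fin => r0|move=> _]; last first.
  exists 1%R => // D g x x0 D0 gx; rewrite mul1e /Lq unlock.
  case: ifPn => _; last by rewrite (@lq_ge0 _ +oo).
  apply/ess_supP; apply: nearW => u /=; rewrite patchE.
  have [Du|_] := boolP (u \in D); last by rewrite abse0 (@lq_ge0 _ +oo).
  move: Du; rewrite inE => Du; have := gx _ _ (dyadic_indexP (D0 _ Du)) Du.
  rewrite rcp_pinfty oppr0 powRr0 mul1e => /le_trans; apply.
  exact: (@lq_ge_term _ +oo).
have ri0 : (0 <= r^-1)%R by rewrite invr_ge0 ltW.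
exists ((expR 1 - 1) `^ r^-1)%R; first exact: powR_gt0.
move=> D g x x0 D0 gx.
have xr0 j : 0 <= x j `^ r by exact: poweR_ge0.
rewrite /Lq unlock.
rewrite -[((_ `^ r^-1)%R)%:E]/((expR 1 - 1)%:E `^ r^-1) -poweRM; last 2 first.
  by rewrite lee_fin ltW.
  exact: esum_ge0.
apply: le_poweR => //; first by apply: integral_ge0 => u _; exact: poweR_ge0.
rewrite -esumZl//.
apply: le_trans (integral_le_esum_dyad
  (c := fun j => (expR (- j%:~R))%:E * x j `^ r) _ _ _ _) _.
- by move=> j; rewrite mule_ge0// lee_fin expR_ge0.
- by move=> u; exact: poweR_ge0.
- move=> u u0; rewrite patchE memNset ?abse0 ?poweR0r ?gt_eqF//.
  by move=> /D0; rewrite ltNge u0.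
- move=> j u ju; rewrite patchE; case: ifPn => [|_]; last first.
    by rewrite abse0 poweR0r ?gt_eqF// mule_ge0// lee_fin expR_ge0.
  rewrite inE => Du; have [u0 /andP[lju _]] := (dyadP j u).1 ju.
  apply: le_trans (le_poweR (ltW r0) (abse_ge0 _) (gx j u ju Du)) _.
  rewrite poweRM ?lee_fin ?powR_ge0//; apply: lee_wpmul2r => //.
  rewrite poweR_EFin lee_fin -powRrM rcp_fin// mulNr mulVf ?gt_eqF//.
  rewrite -[X in (X `^ _)%R](@lnK _ u)// -expRM ler_expR mulrN1 lerN2.
  exact: ltW.
apply: le_esum => j _; rewrite lebesgue_measure_dyad muleAC -EFinM.
by rewrite mulrA -expRD addNr expR0 mul1r.
Qed.

(** Same cancellation as in [Lq_le_lq], now with the lower bound e^(-(j+1)) for 1/u; this is the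
    origin of the factor e^(-1) in [k]. *)
Lemma lq_le_Lq q : 0 < q -> exists2 C : R, (0 < C)%R &
  forall (D : set R) (g : R -> \bar R) y, (forall j, 0 <= y j) ->
  (forall j u, dyad j u -> (u `^ (- rcp q))%:E * y j <= `|(g \_ D) u|) ->
  lq q y <= C%:E * Lq q D g.
Proof.
case: q => [r| |]//; [rewrite lte_fin => r0|move=> _]; last first.
  exists 1%R => // D g y y0 yg; rewrite mul1e /Lq unlock.
  have -> : 0 < lebesgue_measure [set: R] by rewrite -set_itvNyy lebesgue_measure_itv/= ltry.
  apply: ge_ereal_sup => _ [j _ <-]; rewrite leNgt; apply/negP => hj.
  (* If [y j] exceeded the essential supremum, the whole interval of index [j] would lie in a null
     set, although its length is positive. *)
  have [N [mN N0 hN]] := ess_sup_ge (@lebesgue_measure R) (abse \o g \_ D).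
  have : lebesgue_measure (dyad j) <= lebesgue_measure N.
    apply: le_measure; rewrite ?inE//; first exact: measurable_dyad.
    move=> u ju; apply: hN => /= hu; move: hj; apply/negP; rewrite -leNgt.
    apply: le_trans hu; have := yg _ _ ju.
    by rewrite rcp_pinfty oppr0 powRr0 mul1e.
  rewrite N0 lebesgue_measure_dyad lee_fin leNgt mulr_gt0 ?expR_gt0//.
have ri0 : (0 <= r^-1)%R by rewrite invr_ge0 ltW.
pose k := (expR (-1) * (expR 1 - 1) : R)%R.
have k0 : (0 < k)%R by rewrite mulr_gt0// expR_gt0.
exists (k^-1 `^ r^-1)%R; first by rewrite powR_gt0 ?invr_gt0.
move=> D g y y0 yg.
have yr0 j : 0 <= y j `^ r by exact: poweR_ge0.
rewrite /Lq unlock.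
rewrite -[((_ `^ r^-1)%R)%:E]/((k^-1)%:E `^ r^-1) -poweRM; last 2 first.
  by rewrite lee_fin invr_ge0 ltW.
  by apply: integral_ge0 => u _; exact: poweR_ge0.
apply: le_poweR => //; first exact: esum_ge0.
rewrite lee_pdivlMl// -esumZl//.
apply: le_trans (esum_dyad_le_integral
  (c := fun j => (expR (- (j%:~R + 1)))%:E * y j `^ r) _ _ _).
- apply: le_esum => j _; rewrite lebesgue_measure_dyad muleAC -EFinM.
  apply: lee_wpmul2r => //; rewrite lee_fin mulrA -expRD opprD addrAC addNr.
  by rewrite add0r.
- by move=> j; rewrite mule_ge0// lee_fin expR_ge0.
- by move=> u; exact: poweR_ge0.
- move=> j u ju; have [u0 /andP[_ luj]] := (dyadP j u).1 ju.
  apply: (@le_trans _ _ (((u `^ (- rcp r%:E))%:E * y j) `^ r)); last first.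
    by apply: le_poweR (yg j u ju); [exact: ltW|rewrite mule_ge0// lee_fin powR_ge0].
  rewrite poweRM ?lee_fin ?powR_ge0//; apply: lee_wpmul2r => //.
  rewrite poweR_EFin lee_fin -powRrM rcp_fin// mulNr mulVf ?gt_eqF//.
  by rewrite -[X in (X `^ _)%R](@lnK _ u)// -expRM ler_expR mulrN1 lerN2.
Qed.

End Discretization.

(** * Regularly varying functions *)

Section RegularVariation.
Context {R : realType}.
Implicit Types (F G : R -> R) (d e x y : R).

(* In the variable x = ln t, [regvar F d] says that t |-> F (ln t) is t^d times
   a slowly varying function. *)
Definition regvar F d : Prop := (forall x, 0 < F x) /\
  forall e, 0 < e -> exists2 C, 0 < C &
    forall x y, F y <= C * expR (d * (y - x) + e * `|y - x|) * F x.

Lemma regvar_gt0 F d x : regvar F d -> 0 < F x.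
Proof. by case. Qed.

Lemma regvarM F G d d' : regvar F d -> regvar G d' ->
  regvar (fun x => F x * G x) (d + d').
Proof.
move=> [F0 hF] [G0 hG]; split=> [x|e e0]; first exact: mulr_gt0.
have e2 : 0 < e / 2 by rewrite divr_gt0.
have [C C0 {}hF] := hF _ e2; have [C' C'0 {}hG] := hG _ e2.
exists (C * C'); first exact: mulr_gt0.
move=> x y; apply: (le_trans (ler_pM (ltW (F0 y)) (ltW (G0 y)) (hF x y) (hG x y))).
rewrite le_eqVlt; apply/orP; left; apply/eqP.
have -> : (d + d') * (y - x) + e * `|y - x| = (d * (y - x) + e / 2 * `|y - x|) +
  (d' * (y - x) + e / 2 * `|y - x|) by field.
rewrite [in RHS]expRD; ring.
Qed.

Lemma regvarV F d : regvar F d -> regvar (fun x => (F x)^-1) (- d).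
Proof.
move=> [F0 hF]; split=> [x|e e0]; first by rewrite invr_gt0.
have [C C0 {}hF] := hF _ e0; exists C => // x y.
rewrite ler_pdivlMr// mulrC ler_pdivrMr//.
apply: le_trans (hF y x) _; rewrite ler_pM2r// ler_pM2l// ler_expR.
by rewrite (distrC x y) lerD2r; lra.
Qed.

Lemma regvar_expR d : regvar (fun x => expR (d * x)) d.
Proof.
split=> [x|e e0]; first exact: expR_gt0.
exists 1 => // x y; rewrite mul1r -expRD ler_expR.
have : 0 <= e * `|y - x| by rewrite mulr_ge0// ltW.
lra.
Qed.

Lemma regvar_powR F d (s : R) : 0 < s -> regvar F d ->
  regvar (fun x => F x `^ s) (s * d).
Proof.
move=> s0 [F0 hF]; split=> [x|e e0]; first exact: powR_gt0.
have [C C0 {}hF] := hF _ (divr_gt0 e0 s0).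
exists (C `^ s) => [|x y]; first exact: powR_gt0.
have h : 0 <= C * expR (d * (y - x) + e / s * `|y - x|).
  by rewrite mulr_ge0 ?expR_ge0// ltW.
apply: le_trans (ge0_ler_powR (ltW s0) _ _ (hF x y)) _; rewrite ?nnegrE ?(ltW (F0 _))//.
  by rewrite mulr_ge0// ltW.
rewrite powRM ?(ltW (F0 _))// powRM ?(ltW C0) ?expR_ge0// -expRM.
rewrite le_eqVlt; apply/orP; left; apply/eqP.
by congr (_ * expR _ * _); field; rewrite gt_eqF.
Qed.

Lemma regvar_growth F d : regvar F d -> exists2 C, 0 < C &
  forall x y, F y <= C * expR ((`|d| + 1) * `|y - x|) * F x.
Proof.
move=> [F0 hF]; have [C C0 {}hF] := hF 1 ltr01; exists C => // x y.
apply: le_trans (hF x y) _; rewrite ler_pM2r// ler_pM2l// ler_expR.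
by rewrite mulrDl lerD2r -normrM ler_norm.
Qed.

Lemma regvar_local F d : regvar F d -> exists2 C, 0 < C &
  forall x y, `|y - x| <= 1 -> F y <= C * F x.
Proof.
move=> hF; have [C C0 h] := regvar_growth hF.
exists (C * expR (`|d| + 1)); first by rewrite mulr_gt0 ?expR_gt0.
move=> x y xy; apply: le_trans (h x y) _.
rewrite (ler_pM2r (regvar_gt0 _ hF)) ler_pM2l// ler_expR.
by rewrite -[leRHS]mulr1 ler_wpM2l// addr_ge0.
Qed.

(** The whole gap between [d] and [- e] is spent on the slowly varying factor. Here and in
    [regvar_incr] the rate [e] may have either sign. *)
Lemma regvar_decay F d e : regvar F d -> d < - e -> exists2 C, 0 < C &
  forall x y, x <= y -> F y <= C * expR (- e * (y - x)) * F x.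
Proof.
move=> [F0 hF] de; have h : 0 < - e - d by rewrite subr_gt0.
have [C C0 {}hF] := hF _ h; exists C => // x y xy; apply: le_trans (hF x y) _.
rewrite ler_pM2r// ler_pM2l// ler_expR ger0_norm ?subr_ge0//.
lra.
Qed.

Lemma regvar_incr F d e : regvar F d -> e < d -> exists2 C, 0 < C &
  forall x y, y <= x -> F y <= C * expR (- e * (x - y)) * F x.
Proof.
move=> [F0 hF] ed; have h : 0 < d - e by rewrite subr_gt0.
have [C C0 {}hF] := hF _ h; exists C => // x y xy; apply: le_trans (hF x y) _.
rewrite ler_pM2r// ler_pM2l// ler_expR distrC ger0_norm ?subr_ge0//.
lra.
Qed.

(** In additive form, the logarithm of a regularly varying function is affine with slope [d] up to a
    sublinear error; this is the form in which [rho] acts as a change of variable. *)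
Lemma regvar_ln F d e : regvar F d -> 0 < e -> exists2 c, 0 < c &
  forall x y, `|ln (F y) - ln (F x) - d * (y - x)| <= c + e * `|y - x|.
Proof.
move=> [F0 hF] e0; have [C C0 {}hF] := hF _ e0.
exists (`|ln C| + 1) => [|x y]; first by rewrite ltr_wpDl.
have lnh u v : ln (F v) <= `|ln C| + 1 + (d * (v - u) + e * `|v - u|) + ln (F u).
  have := hF u v; rewrite -ler_ln ?posrE ?mulr_gt0 ?expR_gt0//.
  rewrite !lnM ?posrE ?mulr_gt0 ?expR_gt0// expRK.
  move=> /le_trans; apply; rewrite lerD2r lerD2r.
  by rewrite (le_trans (ler_norm _))// lerDl.
rewrite ler_norml; have := lnh x y; have := lnh y x.
rewrite (distrC x y); move: (`|ln C|) (`|y - x|) => A B h1 h2.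
by apply/andP; split; lra.
Qed.

(** [ln G] stretches distances by at most [|d| + 1], up to the constant [c]. The loss allowed for
    [F] is divided by that factor in advance. *)
Lemma regvar_comp F G d : regvar F 0 -> regvar G d ->
  regvar (fun x => F (ln (G x))) 0.
Proof.
move=> [F0 hF] hG; split=> [x|e e0]; first exact: F0.
have [c c0 hc] := regvar_ln hG ltr01.
have M0 : 0 < `|d| + 1 by rewrite ltr_wpDl.
have e'0 : 0 < e / (`|d| + 1) by rewrite divr_gt0.
have [C C0 {}hF] := hF _ e'0.
exists (C * expR (e / (`|d| + 1) * c)); first by rewrite mulr_gt0 ?expR_gt0.
move=> x y; apply: le_trans (hF (ln (G x)) (ln (G y))) _.
rewrite ler_pM2r// -[_ * _ * expR _]mulrA ler_pM2l// -expRD ler_expR !mul0r !add0r.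
have -> : e * `|y - x| = e / (`|d| + 1) * ((`|d| + 1) * `|y - x|).
  by rewrite mulrA divfK// gt_eqF.
rewrite -mulrDr ler_pM2l//.
have -> : ln (G y) - ln (G x) =
  (ln (G y) - ln (G x) - d * (y - x)) + d * (y - x) by rewrite subrK.
apply: le_trans (ler_normD _ _) _; rewrite normrM.
have := hc x y; lra.
Qed.

(** To the right of [x] the almost decreasing function t^(-e) b(t) bounds the growth of b, to the
    left the almost increasing t^e b(t) does. *)
Lemma SV_regvar (b : R -> R) : SV b -> regvar (fun x => b (expR x)) 0.
Proof.
move=> [b0 _ hb]; split=> [x|e e0]; first exact: b0 (expR_gt0 x).
have [[g [g0 gmono [[C1 C10 hC1] [C2 C20 hC2]]]]
      [h [h0 hmono [[C3 C30 hC3] [C4 C40 hC4]]]]] := hb e e0.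
exists (C1 * C2 + C3 * C4); first by rewrite addr_gt0 ?mulr_gt0.
have pE s x : expR x `^ s = expR (s * x) by rewrite mulrC expRM.
have key C s u v : 0 <= C -> expR (s * u) * b (expR u) <= C * (expR (s * v) * b (expR v)) ->
    b (expR u) <= C * expR (s * (v - u)) * b (expR v).
  move=> C0; rewrite -(ler_pM2l (expR_gt0 (- (s * u)))) mulrA -expRD addNr expR0 mul1r.
  move=> /le_trans; apply; rewrite le_eqVlt; apply/orP; left; apply/eqP.
  by rewrite mulrBr expRD; ring.
move=> x y; rewrite mul0r add0r.
have D1 : 0 <= C1 * C2 by rewrite mulr_ge0 ?ltW.
have D2 : 0 <= C3 * C4 by rewrite mulr_ge0 ?ltW.
have bx : 0 < b (expR x) by exact: b0 (expR_gt0 x).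
have [xy|yx] := leP x y.
  apply: (@le_trans _ _ (C3 * C4 * expR (- e * (x - y)) * b (expR x))).
    apply: key => //; rewrite -!pE.
    apply: le_trans (hC3 _ (expR_gt0 _)) _; rewrite -mulrA ler_pM2l//.
    apply: le_trans _ (hC4 _ (expR_gt0 _)).
    by apply: hmono; rewrite ?expR_gt0 ?ler_expR.
  rewrite ler_pM2r// ger0_norm ?subr_ge0// mulNr -mulrN opprB.
  by rewrite ler_pM2r ?expR_gt0// lerDr.
apply: (@le_trans _ _ (C1 * C2 * expR (e * (x - y)) * b (expR x))).
  apply: key => //; rewrite -!pE.
  apply: le_trans (hC1 _ (expR_gt0 _)) _; rewrite -mulrA ler_pM2l//.
  apply: le_trans _ (hC2 _ (expR_gt0 _)).
  by apply: gmono; rewrite ?expR_gt0 ?ler_expR// ltW.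
rewrite ler_pM2r// distrC gtr0_norm ?subr_gt0//.
by rewrite ler_pM2r ?expR_gt0// lerDl.
Qed.

End RegularVariation.

(** * The K-functional *)

Section KFunctional.
Context {R : realType} {V : topologicalLmodType R}.
Implicit Types (X Y : qspace V) (f g : V).

(** This is what positivity, monotonicity and dilation of the K-functional rest on. It is immediate
    for the two interpolation spaces, whose own couple is studied below. *)
Definition norm_finite X := forall f, carrier X f -> (0 <= qnorm X f < +oo)%E.

Lemma quasi_normed_finite X : quasi_normed X -> norm_finite X.
Proof. by move=> [_ _ h _ _] f /h[]. Qed.

Section positive_norms.
Variables X0 X1 : qspace V.
Hypotheses (h0 : norm_finite X0) (h1 : norm_finite X1).
Local Open Scope ereal_scope.

Lemma Kfun_ge0 t f : (0 <= t)%R -> 0 <= Kfun X0 X1 t f.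
Proof.
move=> t0; apply: le_ereal_inf_tmp => _ [f0 [f1 [/h0/andP[f00 _] /h1/andP[f10 _] _ ->]]].
by rewrite adde_ge0// mule_ge0.
Qed.

Lemma Kfun_le t f0 f1 : carrier X0 f0 -> carrier X1 f1 ->
  Kfun X0 X1 t (f0 + f1)%R <= qnorm X0 f0 + t%:E * qnorm X1 f1.
Proof. by move=> X0f0 X1f1; apply: ereal_inf_lbound; exists f0, f1. Qed.

Lemma Kfun_lt_pinfty t f : sum_space X0 X1 f -> Kfun X0 X1 t f < +oo.
Proof.
move=> [f0 [f1 [X0f0 X1f1 ->]]]; apply: le_lt_trans (Kfun_le t X0f0 X1f1) _.
have /andP[n0 n0y] := h0 X0f0; have /andP[n1 n1y] := h1 X1f1.
rewrite lte_add_pinfty// -(@fineK _ (qnorm X1 f1)) ?ge0_fin_numE//.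
by rewrite -EFinM ltry.
Qed.

Lemma le_Kfun s t f : (s <= t)%R -> Kfun X0 X1 s f <= Kfun X0 X1 t f.
Proof.
move=> st; apply: le_ereal_inf_tmp => _ [f0 [f1 [X0f0 X1f1 -> ->]]].
apply: le_trans (Kfun_le s X0f0 X1f1) _; apply: leeD => //.
have /andP[n1 _] := h1 X1f1; exact: lee_wpmul2r.
Qed.

Lemma Kfun_dilate s t f : (0 < s)%R -> (s <= t)%R ->
  Kfun X0 X1 t f <= (t / s)%:E * Kfun X0 X1 s f.
Proof.
move=> s0 st; have t0 : (0 < t)%R := lt_le_trans s0 st.
rewrite -lee_pdivrMl ?divr_gt0//.
apply: le_ereal_inf_tmp => _ [f0 [f1 [X0f0 X1f1 -> ->]]].
rewrite lee_pdivrMl ?divr_gt0//.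
apply: le_trans (Kfun_le t X0f0 X1f1) _.
have /andP[n0 _] := h0 X0f0; have /andP[n1 _] := h1 X1f1.
rewrite ge0_muleDr ?mule_ge0 ?lee_fin ?(ltW s0)//; apply: leeD.
  by rewrite -[leLHS]mul1e lee_wpmul2r// lee_fin ler_pdivlMr ?mul1r.
by rewrite muleA -EFinM divfK ?gt_eqF.
Qed.

End positive_norms.

(* [Kfun] behaves in the variable x = ln t as a nondecreasing function of
   exponential growth at most one. *)
Definition Kshape (k : R -> \bar R) : Prop := (forall x, (0 <= k x)%E) /\
  forall x y, x <= y -> (k x <= k y)%E /\ (k y <= (expR (y - x))%:E * k x)%E.

Lemma Kfun_Kshape X0 X1 f : norm_finite X0 -> norm_finite X1 ->
  Kshape (fun x => Kfun X0 X1 (expR x) f).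
Proof.
move=> h0 h1; split=> [x|x y xy]; first exact: Kfun_ge0 (expR_ge0 x).
split; first by apply: le_Kfun; rewrite ?ler_expR.
rewrite expRD expRN; apply: Kfun_dilate => //; first exact: expR_gt0.
by rewrite ler_expR.
Qed.

Section quasi_norms.
Variables X0 X1 : qspace V.
Hypotheses (q0 : quasi_normed X0) (q1 : quasi_normed X1).

Let h0 := quasi_normed_finite q0.
Let h1 := quasi_normed_finite q1.

(** Faithful on the sum space, where the K-functional is finite; outside it [fine] replaces [+oo] by
    0. *)
Definition Klog x f : R := fine (Kfun X0 X1 (expR x) f).

Lemma KlogE x f : sum_space X0 X1 f -> Kfun X0 X1 (expR x) f = (Klog x f)%:E.
Proof.
move=> hf; rewrite fineK// ge0_fin_numE; first exact: Kfun_lt_pinfty.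
exact: Kfun_ge0 (expR_ge0 x).
Qed.

Lemma Klog_ge0 x f : 0 <= Klog x f.
Proof. by apply: fine_ge0; apply: Kfun_ge0 (expR_ge0 x). Qed.

Lemma carrier0 X : quasi_normed X -> carrier X 0.
Proof. by case. Qed.

Lemma qnorm0 X : quasi_normed X -> qnorm X 0 = 0%E.
Proof. by move=> qX; case: (qX) => [c0 _ h _ _]; have [_ [_]] := h _ c0; apply. Qed.

Lemma carrierN X f : quasi_normed X -> carrier X f ->
  carrier X (- f) /\ qnorm X (- f) = qnorm X f.
Proof.
move=> [c0 hl _ hZ _] Xf; split.
  by have := hl (-1) f 0 Xf c0; rewrite addr0 scaleN1r.
by have := hZ (-1) f Xf; rewrite scaleN1r normrN1 mul1e.
Qed.

Lemma carrierD X f g : quasi_normed X -> carrier X f -> carrier X g ->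
  carrier X (f + g).
Proof. by move=> [_ hl _ _ _] Xf Xg; have := hl 1 f g Xf Xg; rewrite scale1r. Qed.

Lemma sum_space_left f : carrier X0 f -> sum_space X0 X1 f.
Proof. by move=> Xf; exists f, 0; rewrite addr0; split => //; exact: carrier0. Qed.

Lemma sum_space_right f : carrier X1 f -> sum_space X0 X1 f.
Proof. by move=> Xf; exists 0, f; rewrite add0r; split => //; exact: carrier0. Qed.

Lemma sum_spaceD f g : sum_space X0 X1 f -> sum_space X0 X1 g ->
  sum_space X0 X1 (f + g).
Proof.
move=> [f0 [f1 [a b ->]]] [g0 [g1 [c d ->]]]; exists (f0 + g0), (f1 + g1).
by split; [exact: carrierD|exact: carrierD|rewrite addrACA].
Qed.

Lemma Klog_left x f : carrier X0 f -> Klog x f <= fine (qnorm X0 f).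
Proof.
move=> Xf; have /andP[n0 ny] := h0 Xf.
rewrite -lee_fin -KlogE; last exact: sum_space_left.
rewrite fineK ?ge0_fin_numE//.
have := Kfun_le (expR x) Xf (carrier0 q1).
by rewrite addr0 (qnorm0 q1) mule0 adde0.
Qed.

Lemma Klog_right x f : carrier X1 f -> Klog x f <= expR x * fine (qnorm X1 f).
Proof.
move=> Xf; have /andP[n0 ny] := h1 Xf.
rewrite -lee_fin -KlogE; last exact: sum_space_right.
rewrite EFinM fineK ?ge0_fin_numE//.
have := Kfun_le (expR x) (carrier0 q0) Xf.
by rewrite add0r (qnorm0 q0) add0e.
Qed.

Lemma KlogD : exists2 C, 0 < C & forall x f g,
  sum_space X0 X1 f -> sum_space X0 X1 g ->
  Klog x (f + g) <= C * (Klog x f + Klog x g).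
Proof.
have [_ _ _ _ [C0 C01 hC0]] := q0; have [_ _ _ _ [C1 C11 hC1]] := q1.
have C00 : 0 < C0 := lt_le_trans ltr01 C01.
have C10 : 0 < C1 := lt_le_trans ltr01 C11.
exists (C0 + C1) => [|x f g hf hg]; first exact: addr_gt0.
have t0 := expR_gt0 x; set t := expR x in t0.
rewrite -lee_fin EFinM (EFinD (Klog _ _)) -!KlogE//; last exact: sum_spaceD.
rewrite -/t.
have step : forall y z : \bar R,
    (Kfun X0 X1 t f < y)%E -> (Kfun X0 X1 t g < z)%E ->
    (Kfun X0 X1 t (f + g)%R <= (C0 + C1)%:E * (y + z))%E.
  move=> y z /ereal_inf_lt[_ [f0 [f1 [X0f0 X1f1 -> ->]]] hy].
  move=> /ereal_inf_lt[_ [g0 [g1 [X0g0 X1g1 -> ->]]] hz].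
  rewrite addrACA.
  have := Kfun_le t (carrierD q0 X0f0 X0g0) (carrierD q1 X1f1 X1g1).
  move=> /le_trans; apply.
  apply: (@le_trans _ _ ((C0 + C1)%:E * ((qnorm X0 f0 + t%:E * qnorm X1 f1) +
    (qnorm X0 g0 + t%:E * qnorm X1 g1)))%E); last first.
    by rewrite lee_pmul2l ?lte_fin ?addr_gt0// leeD// ltW.
  have /andP[nf0 _] := h0 X0f0; have /andP[nf1 _] := h1 X1f1.
  have /andP[ng0 _] := h0 X0g0; have /andP[ng1 _] := h1 X1g1.
  rewrite addeACA -ge0_muleDr// [leRHS]ge0_muleDr; last 2 first.
  - by rewrite adde_ge0.
  - by rewrite mule_ge0 ?adde_ge0// lee_fin ltW.
  apply: leeD.
    apply: le_trans (hC0 _ _ X0f0 X0g0) _.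
    by rewrite lee_wpmul2r ?adde_ge0// lee_fin lerDl ltW.
  rewrite muleCA lee_pmul2l//.
  apply: le_trans (hC1 _ _ X1f1 X1g1) _.
  by rewrite lee_wpmul2r ?adde_ge0// lee_fin lerDr ltW.
(* The infimum need not be attained. Each K-functional is exceeded by [d], chosen so that the two
   excesses times [C0 + C1] add up to [e]. *)
apply/lee_addgt0Pr => e e0; pose d := e / (2 * (C0 + C1)).
have d0 : 0 < d by rewrite divr_gt0// mulr_gt0// addr_gt0.
have hK g' : sum_space X0 X1 g' -> (Kfun X0 X1 t g' < (Klog x g' + d)%:E)%E.
  by move=> hg'; rewrite /t KlogE// lte_fin ltrDl.
apply: le_trans (step _ _ (hK _ hf) (hK _ hg)) _.
rewrite /t !KlogE// -!EFinD -!EFinM lee_fin le_eqVlt; apply/orP; left; apply/eqP.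
by rewrite /d; field; rewrite gt_eqF// addr_gt0.
Qed.

End quasi_norms.
End KFunctional.

(** * Interpolation norms as sequence norms *)

Section NormDiscretization.
Context {R : realType}.
Implicit Types (q r : \bar R) (K : R -> \bar R) (b : R -> R) (t u : R).
Local Open Scope ereal_scope.

Definition tail (i : int) (x : int -> \bar R) : int -> \bar R :=
  fun j => if (i <= j)%R then x j else 0.

Definition initial (i : int) (x : int -> \bar R) : int -> \bar R :=
  fun j => if (j <= i)%R then x j else 0.

Lemma tail_ge0 i x : (forall j, 0 <= x j) -> forall j, 0 <= tail i x j.
Proof. by move=> x0 j; rewrite /tail; case: ifP. Qed.

Lemma initial_ge0 i x : (forall j, 0 <= x j) -> forall j, 0 <= initial i x j.
Proof. by move=> x0 j; rewrite /initial; case: ifP. Qed.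

(** The integrand of [interp_norm] at e^j, without the factor u^(-1/q) that the measure du/u
    absorbs. *)
Definition weighted (theta : R) b K : int -> \bar R :=
  fun j => (expR (- theta * j%:~R) * b (expR j%:~R))%:E * K (expR j%:~R).

Lemma dyad_ln j u : dyad j u -> [/\ (0 < u)%R, u = expR (ln u),
  (j%:~R <= ln u)%R & (`|ln u - j%:~R| <= 1)%R].
Proof.
move=> /dyadP[u0 /andP[ju uj]]; split => //; first by rewrite lnK.
  exact: ltW.
by rewrite gtr0_norm ?subr_gt0// lerBlDl.
Qed.

Lemma Kshape_dyad K : Kshape (fun x => K (expR x)) -> forall j u, dyad j u ->
  [/\ 0 <= K u, K (expR j%:~R) <= K u & K u <= (expR 1)%:E * K (expR j%:~R)].
Proof.
move=> [K0 hK] j u /dyad_ln[u0 uE ju lej]; have [h1 h2] := hK _ _ ju.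
rewrite uE; split => //; apply: le_trans h2 _; apply: lee_wpmul2r => //.
by rewrite lee_fin ler_expR (le_trans (ler_norm _)).
Qed.

Lemma weighted_ge0 theta b K (d : R) : regvar (fun x => b (expR x)) d ->
  Kshape (fun x => K (expR x)) -> forall j, 0 <= weighted theta b K j.
Proof.
move=> hb [K0 _] j; rewrite mule_ge0// lee_fin mulr_ge0 ?expR_ge0//.
exact: ltW (regvar_gt0 _ hb).
Qed.

Lemma powR_expR (x s : R) : (expR x `^ s = expR (s * x))%R.
Proof. by rewrite mulrC expRM. Qed.

Lemma weighted_dyad theta b d q : regvar (fun x => b (expR x)) d ->
  exists2 C : R, (0 < C)%R & forall K, Kshape (fun x => K (expR x)) ->
  forall j u, dyad j u ->
  [/\ 0 <= (u `^ (- theta - rcp q) * b u)%:E * K u,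
    (u `^ (- theta - rcp q) * b u)%:E * K u <=
      (u `^ (- rcp q))%:E * (C%:E * weighted theta b K j)
  & (u `^ (- rcp q))%:E * weighted theta b K j <=
      C%:E * ((u `^ (- theta - rcp q) * b u)%:E * K u)].
Proof.
move=> hb.
have hF := regvarM (regvar_expR (- theta)) hb.
have [C C0 hC] := regvar_local hF; have F0 := regvar_gt0 _ hF.
exists (C * expR 1)%R => [|K hK j u ju]; first by rewrite mulr_gt0 ?expR_gt0.
have [K0 Ku uK] := Kshape_dyad hK ju.
have [u0 uE lej lej1] := dyad_ln ju.
have hp : (u `^ (- theta - rcp q) * b u =
    u `^ (- rcp q) * (expR (- theta * ln u) * b (expR (ln u))))%R.
  by rewrite {1 3}uE !powR_expR mulrA -expRD -uE; congr (expR _ * _)%R; ring.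
rewrite hp EFinM -!muleA.
have P0 : 0 <= (u `^ (- rcp q))%:E :> \bar R by rewrite lee_fin powR_ge0.
have W0 : 0 <= (expR (- theta * ln u) * b (expR (ln u)))%:E.
  by rewrite lee_fin ltW// F0.
have V0 : 0 <= (expR (- theta * j%:~R) * b (expR j%:~R))%:E.
  by rewrite lee_fin ltW// F0.
split; first by rewrite !mule_ge0.
  apply: lee_wpmul2l => //; rewrite /weighted.
  rewrite (EFinM C) muleACA -EFinM; apply: lee_pmul => //.
  by rewrite lee_fin hC// lej1.
rewrite [leRHS]muleCA; apply: lee_wpmul2l => //; rewrite /weighted (EFinM C) muleACA -EFinM.
have K0' : 0 <= K (expR j%:~R) by case: hK.
apply: lee_pmul => //; first by rewrite lee_fin hC// distrC.
apply: le_trans Ku _; rewrite -[leLHS]mul1e lee_wpmul2r// lee_fin.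
by rewrite -expR0 ler_expR.
Qed.

Lemma dyad_tail i t j u : dyad i t -> dyad j u -> (t < u)%R -> (i <= j)%R.
Proof.
move=> /dyadP[t0 /andP[it _]] /dyadP[u0 /andP[_ uj]] tu.
have lntu : (ln t < ln u)%R by rewrite ltr_ln.
have := lt_le_trans (lt_trans it lntu) uj.
by rewrite -[1%R]/(1%:~R) -intrD ltr_int ltzD1.
Qed.

Lemma tail_dyad i t j u : dyad i t -> dyad j u -> (i + 1 <= j)%R -> (t < u)%R.
Proof.
move=> /dyadP[t0 /andP[_ ti]] /dyadP[u0 /andP[ju _]] ij.
rewrite -ltr_ln//; apply: le_lt_trans ti (le_lt_trans _ ju).
by rewrite -[1%R]/(1%:~R) -intrD ler_int.
Qed.

(** For [t] in the interval of index [i], the half-line from [t] covers that interval only in part: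
    it enters the upper bound, but the lower bound sees indices from [i + 1] on. *)
Lemma interp_norm_dyadic theta b d q : 0 < q -> regvar (fun x => b (expR x)) d ->
  exists2 C : R, (0 < C)%R & forall K, Kshape (fun x => K (expR x)) ->
  let g u := (u `^ (- theta - rcp q) * b u)%:E * K u in
  let v := weighted theta b K in
  [/\ Lq q `]0%R, +oo[ g <= C%:E * lq q v,
      lq q v <= C%:E * Lq q `]0%R, +oo[ g,
      forall i t, dyad i t -> Lq q `]t, +oo[ g <= C%:E * lq q (tail i v)
    & forall i t, dyad i t -> lq q (tail (i + 1) v) <= C%:E * Lq q `]t, +oo[ g].
Proof.
move=> q0 hb; have [C1 C10 hC1] := Lq_le_lq q0; have [C2 C20 hC2] := lq_le_Lq q0.
have [C C0 hC] := weighted_dyad theta q hb.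
exists ((C1 + C2) * C)%R; first by rewrite mulr_gt0// addr_gt0.
move=> K hK g v; have v0 := weighted_ge0 theta hb hK.
have gv := hC K hK.
have Lq_ge0 D : 0 <= Lq q D g by exact: Lnorm_ge0.
have up D x : (forall u, D u -> (0 < u)%R) -> (forall j, 0 <= x j) ->
    (forall j u, dyad j u -> D u -> v j <= x j) ->
    Lq q D g <= ((C1 + C2) * C)%:E * lq q x.
  move=> D0 x0 vx; apply: (@le_trans _ _ (C1%:E * lq q (fun j => C%:E * x j))).
    apply: hC1 => // [j|j u ju Du]; first by rewrite mule_ge0// lee_fin ltW.
    have [g0 gle _] := gv j u ju; rewrite gee0_abs//; apply: le_trans gle _.
    rewrite lee_wpmul2l ?lee_fin ?powR_ge0// lee_wpmul2l ?lee_fin ?(ltW C0)//.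
    exact: vx ju Du.
  rewrite lqZ// muleA -EFinM lee_wpmul2r ?lq_ge0// lee_fin ler_pM2r//.
  by rewrite lerDl ltW.
have low D x : (forall j, 0 <= x j) ->
    (forall j u, dyad j u -> x j = 0 \/ (D u /\ x j <= v j)) ->
    lq q x <= ((C1 + C2) * C)%:E * Lq q D g.
  move=> x0 vx; apply: (@le_trans _ _ ((C2 * C)%:E * Lq q D g)); last first.
    by rewrite lee_wpmul2r// lee_fin ler_pM2r// lerDr ltW.
  rewrite [(C2 * C)%R]mulrC EFinM -muleA -lee_pdivrMl// -lqZ ?invr_gt0//.
  apply: hC2 => [j|j u ju]; first by rewrite mule_ge0// lee_fin invr_ge0 ltW.
  have [->|[Du xv]] := vx _ _ ju; first by rewrite !mule0 abse_ge0.
  have [g0 _ gge] := gv j u ju; rewrite patchE mem_set// gee0_abs//.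
  rewrite muleCA lee_pdivrMl//; apply: le_trans gge.
  by rewrite lee_wpmul2l// lee_fin powR_ge0.
split.
- by apply: up => // u; rewrite /= in_itv/= andbT.
- apply: low => // j u /dyad_ln[u0 _ _ _]; right; split => //.
  by rewrite /= in_itv/= andbT.
- move=> i t it; have [t0 _ _ _] := dyad_ln it; apply: up.
  + by move=> u; rewrite /= in_itv/= andbT; exact: lt_trans.
  + exact: tail_ge0.
  + move=> j u ju; rewrite /= in_itv/= andbT /tail => tu.
    by rewrite (dyad_tail it ju tu).
- move=> i t it; apply: low; first exact: tail_ge0.
  move=> j u ju; rewrite /tail; case: ifPn => [ij|]; last by left.
  by right; split => //; rewrite /= in_itv/= andbT (tail_dyad it ju ij).
Qed.

Lemma interpR_norm_dyadic sigma a b da db q r : 0 < q -> 0 < r ->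
  regvar (fun x => a (expR x)) da -> regvar (fun x => b (expR x)) db ->
  exists2 C : R, (0 < C)%R & forall K, Kshape (fun x => K (expR x)) ->
  let N := Lq r `]0%R, +oo[ (fun t => (t `^ (- rcp r) * (b t / a t))%:E *
      Lq q `]t, +oo[ (fun u => (u `^ (- sigma - rcp q) * a u)%:E * K u)) in
  let v i := (b (expR i%:~R) / a (expR i%:~R))%:E *
    lq q (tail i (weighted sigma a K)) in
  N <= C%:E * lq r v /\ lq r v <= C%:E * N.
Proof.
move=> q0 r0 ha hb; have hw := regvarM hb (regvarV ha).
have [C1 C10 hC1] := Lq_le_lq r0; have [C2 C20 hC2] := lq_le_Lq r0.
have [C3 C30 hC3] := interp_norm_dyadic sigma q0 ha.
have [C4 C40 hC4] := regvar_local hw; have [C5 C50 hC5] := lq_shift r0.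
pose M := (C4 * C3)%R; have M0 : (0 < M)%R by rewrite mulr_gt0.
exists ((C1 + C5 * C4 * C2) * M)%R.
  by rewrite mulr_gt0// addr_gt0// !mulr_gt0.
move=> K hK N v; have [_ _ hup hlow] := hC3 K hK.
have v0 := weighted_ge0 sigma ha hK.
have T0 i : 0 <= lq q (tail i (weighted sigma a K)).
  by apply: lq_ge0 => //; exact: tail_ge0.
have L0 t : 0 <= Lq q `]t, +oo[ (fun u => (u `^ (- sigma - rcp q) * a u)%:E * K u).
  exact: Lnorm_ge0.
have w0 x : (0 < b (expR x) / a (expR x))%R := regvar_gt0 x hw.
have vv0 i : 0 <= v i by rewrite mule_ge0// lee_fin ltW.
have N0 : 0 <= N by exact: Lnorm_ge0.
split.
  apply: (@le_trans _ _ (C1%:E * lq r (fun j => M%:E * v j))); last first.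
    rewrite lqZ// muleA -EFinM lee_wpmul2r ?lq_ge0// lee_fin ler_pM2r// lerDl.
    by rewrite !mulr_ge0// ltW.
  apply: hC1 => [j|u|j u ju _].
  - by rewrite mule_ge0// lee_fin ltW.
  - by rewrite /= in_itv/= andbT.
  have [u0 uE lej lej1] := dyad_ln ju.
  have wu0 : (0 < b u / a u)%R by rewrite uE.
  rewrite gee0_abs; last by rewrite mule_ge0// lee_fin mulr_ge0 ?powR_ge0// ltW.
  rewrite EFinM -muleA; apply: lee_wpmul2l; first by rewrite lee_fin powR_ge0.
  rewrite /v /M (EFinM C4) muleACA -EFinM; apply: lee_pmul => //.
  - by rewrite lee_fin ltW.
  - by rewrite lee_fin {1 2}uE; exact: hC4.
  - exact: hup.
(* From below only the tail starting at [k + 1] is available. Re-indexing by one repairs this,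
   because the outer weight changes by a bounded factor. *)
pose y k := (b (expR k%:~R) / a (expR k%:~R))%:E *
  lq q (tail (k + 1) (weighted sigma a K)).
have y0 k : 0 <= y k by rewrite mule_ge0// lee_fin ltW.
apply: (@le_trans _ _ (C5%:E * lq r (fun k => C4%:E * y k))).
  apply: (hC5 1%R) => // [j|j]; first by rewrite mule_ge0// lee_fin ltW.
  rewrite /v /y subrK muleA -EFinM lee_wpmul2r// lee_fin hC4//.
  by rewrite intrB opprB addrC subrK normr1.
rewrite lqZ//; apply: (@le_trans _ _ ((C5 * C4)%:E * (M%:E * (C2%:E * N)))).
  rewrite muleA -EFinM lee_wpmul2l//; first by rewrite lee_fin mulr_ge0// ltW.
  rewrite -lee_pdivrMl// -lqZ ?invr_gt0//.
  apply: hC2 => [j|j u ju]; first by rewrite mule_ge0// lee_fin invr_ge0 ltW.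
  have [u0 uE lej lej1] := dyad_ln ju.
  have wu0 : (0 < b u / a u)%R by rewrite uE.
  rewrite patchE mem_set; last by rewrite /= in_itv/= andbT.
  rewrite gee0_abs; last by rewrite mule_ge0// lee_fin mulr_ge0 ?powR_ge0// ltW.
  rewrite EFinM -muleA; apply: lee_wpmul2l; first by rewrite lee_fin powR_ge0.
  rewrite lee_pdivrMl// /y /M (EFinM C4) muleACA -EFinM; apply: lee_pmul => //.
  - by rewrite lee_fin ltW.
  - by rewrite lee_fin [X in (_ <= _ * (b X / _))%R]uE
      [X in (_ <= _ * (_ / a X))%R]uE; apply: hC4; rewrite distrC.
  - exact: hlow.
rewrite !muleA -!EFinM lee_wpmul2r// lee_fin.
have := ltW (mulr_gt0 C10 M0); rewrite mulrDl; lra.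
Qed.

(** Slow variation of the norm over (0,t) follows from that of the integrand: translating the
    logarithmic variable changes each term, hence the norm, by a factor e^(e|y - x|) at most. *)
Lemma regvar_initial_norm (be : R -> R) r : 0 < r ->
  regvar (fun x => be (expR x)) 0 ->
  Lq r `]0%R, 1%R[ (fun s => (s `^ (- rcp r) * be s)%:E) < +oo ->
  let B t := fine (Lq r `]0%R, t[ (fun s => (s `^ (- rcp r) * be s)%:E)) in
  regvar (fun x => B (expR x)) 0 /\
  exists2 C : R, (0 < C)%R & forall i : int,
    (B (expR i%:~R))%:E <= C%:E * lq r (initial i (fun j => (be (expR j%:~R))%:E)) /\
    lq r (initial i (fun j => (be (expR j%:~R))%:E)) <= (C * B (expR i%:~R))%:E.
Proof.
move=> r0 hbe hfin B.
have be0 x : (0 < be (expR x))%R := regvar_gt0 x hbe.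
pose v (j : int) := (be (expR j%:~R))%:E.
have v0 j : 0 <= v j by rewrite lee_fin ltW.
have ini0 i : 0 <= lq r (initial i v) by apply: lq_ge0 => //; exact: initial_ge0.
pose L t := Lq r `]0%R, t[ (fun s => (s `^ (- rcp r) * be s)%:E).
have L0 t : 0 <= L t by exact: Lnorm_ge0.
have [C1 C10 hC1] := Lq_le_lq r0; have [C2 C20 hC2] := lq_le_Lq r0.
have [C3 C30 hC3] := regvar_local hbe.
have up i t : dyad i t -> L t <= (C1 * C3)%:E * lq r (initial i v).
  move=> it; rewrite EFinM -muleA -lqZ//; last exact: initial_ge0.
  apply: hC1 => [j|u|j u ju].
  - by rewrite mule_ge0 ?initial_ge0// lee_fin ltW.
  - by rewrite /= in_itv/= => /andP[].
  move=> Du; have /andP[_ ut] : (0 < u < t)%R by move: Du; rewrite /= in_itv.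
  have [u0 uE lej lej1] := dyad_ln ju.
  rewrite gee0_abs; last first.
    by rewrite lee_fin mulr_ge0 ?powR_ge0// uE ltW.
  rewrite EFinM; apply: lee_wpmul2l; first by rewrite lee_fin powR_ge0.
  rewrite /initial (dyad_tail ju it ut) -EFinM lee_fin {1}uE.
  exact: hC3.
(* The interval of index [i] contains [t], so it is not inside ]0, t[ and the lower bound stops at
   [i - 1]; [grow] supplies the missing term. *)
have low i t : dyad i t -> lq r (initial (i - 1) v) <= (C2 * C3)%:E * L t.
  move=> it; rewrite [(C2 * _)%R]mulrC EFinM -muleA -lee_pdivrMl// -lqZ ?invr_gt0//; last first.
    exact: initial_ge0.
  apply: hC2 => [j|j u ju].
    by rewrite mule_ge0 ?initial_ge0// lee_fin invr_ge0 ltW.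
  rewrite /initial; case: ifPn => [ji|]; last by rewrite !mule0 abse_ge0.
  have [u0 uE lej lej1] := dyad_ln ju.
  have ut : (u < t)%R by apply: tail_dyad ju it _; rewrite -lerBrDr.
  rewrite patchE mem_set; last by rewrite /= in_itv/= u0.
  rewrite gee0_abs; last by rewrite lee_fin mulr_ge0 ?powR_ge0// uE ltW.
  rewrite EFinM; apply: lee_wpmul2l; first by rewrite lee_fin powR_ge0.
  rewrite lee_pdivrMl// -EFinM lee_fin [X in (_ <= _ * be X)%R]uE.
  by apply: hC3; rewrite distrC.
(* For [i <= j] this is monotonicity. For [i > j] the segment is shifted by [i - j], at the price of
   the slow variation of [be]; the uniform constant of [lq_shift] covers all shifts at once. *)
have grow (e : R) : (0 < e)%R -> exists2 C : R, (0 < C)%R & forall i j : int,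
    lq r (initial i v) <= (C * expR (e * `|i%:~R - j%:~R|))%:E * lq r (initial j v).
  move=> e0; have [C4 C40 hC4] := hbe.2 e e0; have [D D0 hD] := lq_shift r0.
  exists (1 + D * C4)%R => [|i j]; first by rewrite addr_gt0// mulr_gt0.
  have X0 : (0 < expR (e * `|i%:~R - j%:~R|) :> R)%R by exact: expR_gt0.
  have [ij|ji] := leP i j.
    apply: (@le_trans _ _ (lq r (initial j v))).
      apply: lq_le => // [k|k]; first exact: initial_ge0.
      rewrite /initial; case: ifPn => ki; last by case: ifP.
      by rewrite (le_trans ki ij).
    rewrite -[leLHS]mul1e lee_wpmul2r// lee_fin -[leLHS]mulr1; apply: ler_pM => //.
      by rewrite lerDl mulr_ge0// ltW.
    by rewrite -expR0 ler_expR mulr_ge0// ltW.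
  apply: (@le_trans _ _ ((D * (C4 * expR (e * `|i%:~R - j%:~R|)))%:E *
      lq r (initial j v))); last first.
    by rewrite lee_wpmul2r// lee_fin mulrA ler_pM2r// lerDr.
  rewrite EFinM -muleA -lqZ ?mulr_gt0//; last exact: initial_ge0.
  apply: (hD (i - j)%R) => [k|k|k].
  - exact: initial_ge0.
  - by rewrite mule_ge0 ?initial_ge0// lee_fin mulr_ge0// ltW.
  rewrite /initial; case: ifPn => ki; last first.
    by case: ifP => //; rewrite ?mule0// mule_ge0// lee_fin mulr_ge0// ltW.
  have -> : (k - (i - j) <= j)%R by rewrite opprB addrCA gerDl subr_le0.
  rewrite -EFinM lee_fin; apply: le_trans (hC4 (k - (i - j))%:~R k%:~R) _.
  rewrite mul0r add0r.
  by have -> : (k%:~R - (k - (i - j))%:~R = i%:~R - j%:~R :> R)%R by rewrite !intrB; ring.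
(* The intervals are closed on the right, so e^i is the last point of the one with index [i - 1]. *)
have dexp (i : int) : dyad (i - 1) (expR i%:~R : R).
  apply/dyadP; split; first exact: expR_gt0.
  by rewrite expRK intrB; apply/andP; split; lra.
(* The point 1 has index -1, so the hypothesis on ]0, 1[ controls the segment up to -2; [grow]
   carries finiteness to every [i]. *)
have fin i : lq r (initial i v) < +oo.
  have [C4 C40 hC4] := grow 1%R ltr01.
  have := hC4 i (-1 - 1)%R => /le_lt_trans; apply.
  have d0 : dyad (-1) (1%R : R) by have := dexp 0%R; rewrite expR0 sub0r.
  have h := le_lt_trans (low _ _ d0) _.
  rewrite lte_mul_pinfty ?lee_fin ?mulr_ge0 ?expR_ge0 ?(ltW C40)//.
  by apply: h; rewrite lte_mul_pinfty ?lee_fin ?mulr_ge0 ?(ltW C20) ?(ltW C30).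
have Lfin t : (0 < t)%R -> L t = (B t)%:E.
  move=> t0; rewrite /B fineK// (ge0_fin_numE (L0 t)).
  apply: le_lt_trans (up _ _ (dyadic_indexP t0)) _.
  by rewrite lte_mul_pinfty ?lee_fin ?mulr_ge0 ?(ltW C10) ?(ltW C30).
have key (e : R) : (0 < e)%R -> exists2 C : R, (0 < C)%R & forall x y,
    L (expR y) <= (C * expR (e * `|y - x|))%:E * L (expR x).
  move=> e0; have [C4 C40 hC4] := grow e e0.
  exists (C1 * C3 * (C4 * expR (e * 2)) * (C2 * C3))%R.
    by rewrite !mulr_gt0// expR_gt0.
  move=> x y; have [iy ix] := (dyadic_indexP (expR_gt0 y), dyadic_indexP (expR_gt0 x)).
  apply: le_trans (up _ _ iy) _.
  set i := dyadic_index (expR y) in iy *; set j := dyadic_index (expR x) in ix *.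
  have dij : (`|i%:~R - (j - 1)%:~R| <= 2 + `|y - x| :> R)%R.
    have /dyadP[_] := iy; have /dyadP[_] := ix; rewrite !expRK => /andP[x1 x2] /andP[y1 y2].
    have -> : ((j - 1)%:~R = j%:~R - 1 :> R)%R by rewrite intrB.
    have := ler_norm (y - x); have := ler_norm (x - y).
    by rewrite (distrC x y) ler_norml => h1 h2; apply/andP; split; lra.
  apply: (@le_trans _ _ ((C1 * C3)%:E * ((C4 * expR (e * (2 + `|y - x|)))%:E *
      ((C2 * C3)%:E * L (expR x))))).
    apply: lee_wpmul2l; first by rewrite lee_fin mulr_ge0// ltW.
    apply: le_trans (hC4 i (j - 1)%R) _; apply: lee_pmul => //.
    + by rewrite lee_fin mulr_ge0 ?expR_ge0// ltW.
    + by rewrite lee_fin ler_pM2l// ler_expR ler_pM2l.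
    + exact: low.
  rewrite !muleA -!EFinM lee_wpmul2r// lee_fin le_eqVlt; apply/orP; left; apply/eqP.
  by rewrite mulrDr expRD; ring.
have Bpos x : (0 < B (expR x))%R.
  rewrite -lte_fin -Lfin ?expR_gt0//.
  have ix := dyadic_indexP (expR_gt0 x); set i := dyadic_index (expR x) in ix *.
  have : 0 < (C2 * C3)%:E * L (expR x).
    apply: lt_le_trans (low _ _ ix).
    apply: (@lt_le_trans _ _ (initial (i - 1) v (i - 1)%R)).
      by rewrite /initial lexx lte_fin.
    by apply: lq_ge_term => //; exact: initial_ge0.
  by rewrite pmule_rgt0// lte_fin mulr_gt0.
split.
  split => // e e0; have [C C0 hC] := key e e0; exists C => // x y.
  by have := hC x y; rewrite !Lfin ?expR_gt0// -EFinM lee_fin mul0r add0r.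
have [C4 C40 hC4] := grow 1%R ltr01.
exists (C1 * C3 + C4 * expR 2 * (C2 * C3))%R.
  by rewrite addr_gt0 ?mulr_gt0 ?expR_gt0.
move=> i; split.
  rewrite -Lfin ?expR_gt0//; apply: le_trans (up _ _ (dexp i)) _.
  apply: (@le_trans _ _ ((C1 * C3)%:E * lq r (initial i v))).
    apply: lee_wpmul2l; first by rewrite lee_fin mulr_ge0// ltW.
    apply: lq_le => // [k|k]; first exact: initial_ge0.
    rewrite /initial; case: ifPn => ki; last by case: ifP.
    by rewrite (le_trans ki)// gerBl.
  by rewrite lee_wpmul2r// lee_fin lerDl !mulr_ge0 ?expR_ge0 ?(ltW C40) ?(ltW C20) ?(ltW C30).
rewrite EFinM -Lfin ?expR_gt0//; apply: le_trans (hC4 i (i - 1 - 1)%R) _.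
apply: (@le_trans _ _ ((C4 * expR 2)%:E * ((C2 * C3)%:E * L (expR i%:~R)))).
  apply: lee_pmul => //.
  - by rewrite lee_fin mulr_ge0 ?expR_ge0// ltW.
  - rewrite lee_fin ler_pM2l// ler_expR mul1r !intrB ger0_norm; lra.
  - exact: low.
by rewrite muleA -EFinM lee_wpmul2r// lee_fin lerDr mulr_ge0// ltW.
Qed.

End NormDiscretization.

(** * Hardy inequalities and change of variable *)

Section DiscreteHardy.
Context {R : realType}.
Implicit Types (q : \bar R).

Lemma lq_sup q (e C : R) : (0 < q)%E -> 0 < e -> 0 < C ->
  exists2 D : R, 0 < D & forall (x y : int -> \bar R) (m : int -> int),
  (forall j, 0 <= x j)%E -> (forall j, 0 <= y j)%E ->
  (forall j, x j <= ereal_sup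
     [set (C * expR (- e * `|j%:~R - (m k)%:~R|))%:E * y k | k in setT])%E ->
  (lq q x <= D%:E * lq q y)%E.
Proof.
move=> q0 e0 C0; have [D D0 hD] := lq_schur q0 e0.
exists (D * C) => [|x y m x0 y0 xy]; first exact: mulr_gt0.
rewrite EFinM -muleA -lqZ//.
apply: (hD x (fun k => C%:E * y k)%E m) => // [j|j].
  by rewrite mule_ge0// lee_fin ltW.
apply: le_trans (xy j) _; apply: ge_ereal_sup => _ [k _ <-].
apply: ereal_sup_ubound; exists k => //.
by rewrite [in RHS]mulrC EFinM muleA.
Qed.

(** Comparison at bounded distance: within [L] the Schur kernel of rate 1 is at least e^(-L), so a
    factor e^L compensates it. *)
Lemma lq_near q (L C : R) : (0 < q)%E -> 0 < C ->
  exists2 D : R, 0 < D & forall (x y : int -> \bar R) (m : int -> int),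
  (forall j, 0 <= x j)%E -> (forall j, 0 <= y j)%E ->
  (forall j, exists2 k, `|j%:~R - (m k)%:~R| <= L & (x j <= C%:E * y k)%E) ->
  (lq q x <= D%:E * lq q y)%E.
Proof.
move=> q0 C0; have CL0 : 0 < C * expR L by rewrite mulr_gt0 ?expR_gt0.
have [D D0 hD] := lq_sup q0 ltr01 CL0; exists D => // x y m x0 y0 xy.
apply: (hD x y m x0 y0) => j; have [k jk xk] := xy j.
apply: le_ereal_sup_tmp; eexists; first by exists k.
apply: le_trans xk _; apply: lee_wpmul2r => //.
rewrite lee_fin -mulrA ler_peMr ?(ltW C0)// -expRD -[leLHS]expR0 ler_expR.
by rewrite mulN1r subr_ge0.
Qed.

Section change_of_variable.
Variables (F : R -> R) (d : R).
Hypotheses (hF : regvar F d) (d0 : 0 < d).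

Let r x := ln (F x).

Lemma ln_regvar_bounds : exists2 c, 0 < c &
  forall x y, x <= y -> d / 2 * (y - x) - c <= r y - r x <= 2 * d * (y - x) + c.
Proof.
have d20 : 0 < d / 2 by rewrite divr_gt0.
have [c c0 hc] := regvar_ln hF d20; exists c => // x y xy.
have := hc x y; rewrite -/(r _) -/(r _) (@ger0_norm _ (y - x)) ?subr_ge0//.
rewrite ler_norml => /andP[h1 h2].
have : 0 <= d * (y - x) by rewrite mulr_ge0 ?subr_ge0// ltW.
by move=> h3; apply/andP; split; lra.
Qed.

(** A substitute for the inverse of [r], which may be neither monotone nor continuous: take the last
    integer before [r] first exceeds [z]. One more step raises [r] by at most [2 * d + c]. *)
Lemma regvar_nearest : exists L : R, forall z, exists k : int, `|z - r k%:~R| <= L.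
Proof.
have [c c0 hc] := ln_regvar_bounds; exists (2 * d + c) => z.
(* With slope at least [d / 2] and defect [c], this [N] ensures that [r] is at most [z] at [-N] and
   above [z] at [N]; the search therefore succeeds, and not at its first index. *)
pose N := Num.bound (2 / d * (`|z - r 0| + c)).
have hN : `|z - r 0| + c < d / 2 * N%:R.
  have : 2 / d * (`|z - r 0| + c) < N%:R.
    by apply: archi_boundP; rewrite mulr_ge0 ?divr_ge0 ?addr_ge0 ?(ltW d0) ?(ltW c0).
  by rewrite -(@ltr_pM2l _ (d / 2)) ?divr_gt0// mulrA
    (_ : d / 2 * (2 / d) = 1) ?mul1r//; field; rewrite gt_eqF.
have N0 : 0 <= N%:R :> R by [].
pose P (n : nat) := z < r (n%:R - N%:R).
have exP : exists n, P n.
  exists (N + N)%N; rewrite /P natrD addrK.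
  have /andP[h _] := hc 0 N%:R N0; have := ler_norm (z - r 0).
  by move: h; rewrite subr0; lra.
case: (ex_minnP exP) => n Pn nmin.
have n0 : (0 < n)%N.
  rewrite lt0n; apply: contraTneq Pn => ->; rewrite /P sub0r -leNgt.
  have N0' : - N%:R <= 0 :> R by rewrite oppr_le0.
  have /andP[h _] := hc _ _ N0'; have := ler_norm (- (z - r 0)).
  by rewrite normrN; move: h; rewrite sub0r opprK; lra.
exists (n.-1%:Z - N%:Z); set x : R := n.-1%:R - N%:R.
have -> : (n.-1%:Z - N%:Z)%:~R = x :> R by rewrite intrB.
have zx : r x <= z.
  rewrite leNgt; apply/negP => h; have := nmin _ h.
  by rewrite leqNgt prednK// leqnn.
have xz : z < r (x + 1).
  by move: Pn; rewrite /P -{1}(prednK n0) -natr1 addrAC.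
have xx1 : x <= x + 1 by rewrite lerDl.
have /andP[_] := hc _ _ xx1; rewrite ger0_norm ?subr_ge0//; lra.
Qed.

(** Two uses of [lq_near]. Each integer [j] is close to some [r k], and each [r i] is close to its
    floor; in the second case the indices [i] sharing a floor stay together because [r] has positive
    slope. *)
Lemma lq_change_of_variable q (M C : R) : (0 < q)%E -> 0 < C -> 0 <= M ->
  exists2 D : R, 0 < D & forall phi : R -> \bar R,
  (forall x, 0 <= phi x)%E ->
  (forall x y, phi y <= (C * expR (M * `|y - x|))%:E * phi x)%E ->
  (lq q (fun j => phi j%:~R) <= D%:E * lq q (fun j => phi (r j%:~R)))%E /\
  (lq q (fun j => phi (r j%:~R)) <= D%:E * lq q (fun j => phi j%:~R))%E.
Proof.
move=> q0 C0 M0; have [L /choice[kz hkz]] := regvar_nearest.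
have [c c0 hc] := ln_regvar_bounds.
have C10 : 0 < C * expR (M * L) by rewrite mulr_gt0 ?expR_gt0.
have C20 : 0 < C * expR M by rewrite mulr_gt0 ?expR_gt0.
have [D1 D10 hD1] := lq_near (L + 1) q0 C10.
have [D2 D20 hD2] := lq_near (2 / d * (1 + L + c)) q0 C20.
exists (D1 + D2) => [|phi phi0 hphi]; first exact: addr_gt0.
have floor1 (z : R) : `|z - (Num.floor z)%:~R| <= 1.
  have /andP[h1 h2] := floor_itv z; rewrite ger0_norm ?subr_ge0//.
  by move: h2; rewrite intrD; lra.
have near_phi (z w l : R) : `|w - z| <= l -> (phi w <= (C * expR (M * l))%:E * phi z)%E.
  move=> wz; apply: le_trans (hphi z w) _; apply: lee_wpmul2r => //.
  by rewrite lee_fin ler_pM2l// ler_expR ler_wpM2l.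
have grow D : 0 < D -> D <= D1 + D2 -> forall x y : int -> \bar R, (forall j, 0 <= y j)%E ->
    (lq q x <= D%:E * lq q y)%E -> (lq q x <= (D1 + D2)%:E * lq q y)%E.
  move=> D0 DD x y y0 /le_trans; apply.
  by apply: lee_wpmul2r; rewrite ?lq_ge0 ?lee_fin.
split.
  apply: (grow D1) => //; first by rewrite lerDl ltW.
  apply: (hD1 _ _ (fun k => Num.floor (r k%:~R))) => // j.
  exists (kz j%:~R); last exact: near_phi (hkz _).
  apply: le_trans (ler_distD (r (kz j%:~R)%:~R) _ _) _.
  by apply: lerD; [exact: hkz|exact: floor1].
apply: (grow D2) => //; first by rewrite lerDr ltW.
apply: (hD2 _ _ (fun j => kz j%:~R)) => // i.
exists (Num.floor (r i%:~R)); last first.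
  by have := near_phi _ _ _ (floor1 (r i%:~R)); rewrite mulr1.
set j := Num.floor _; set x : R := i%:~R; set y : R := (kz j%:~R)%:~R.
have rxy : `|r x - r y| <= 1 + L.
  apply: le_trans (ler_distD (j%:~R) _ _) _.
  by apply: lerD; [exact: floor1|exact: hkz].
(* The slope [d / 2] of [r], with defect [c], turns closeness of values into closeness of
   arguments. *)
have key u v : u <= v -> `|r v - r u| <= 1 + L -> v - u <= 2 / d * (1 + L + c).
  move=> uv ruv; have /andP[h _] := hc _ _ uv.
  rewrite -(@ler_pM2l _ (d / 2)) ?divr_gt0// mulrA
    (_ : d / 2 * (2 / d) = 1) ?mul1r; last by field; rewrite gt_eqF.
  have := ler_norm (r v - r u); lra.
have [xy|/ltW yx] := leP x y.
  by rewrite distrC ger0_norm ?subr_ge0//; apply: key => //; rewrite distrC.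
by rewrite ger0_norm ?subr_ge0//; exact: key.
Qed.

End change_of_variable.
End DiscreteHardy.

(** * Holmstedt estimates and reiteration *)

Section Holmstedt.
Context {R : realType} {V : topologicalLmodType R}.
Variables (A0 A1 : qspace V) (theta0 theta1 : R) (q0 r0 r1 : \bar R).
Variables (a0 b0 b1 B : R -> R).
Hypotheses (qA0 : quasi_normed A0) (qA1 : quasi_normed A1).
Hypotheses (theta0_gt0 : 0 < theta0) (theta01 : theta0 < theta1)
  (theta1_lt1 : theta1 < 1).
Hypotheses (q0_gt0 : (0 < q0)%E) (r0_gt0 : (0 < r0)%E) (r1_gt0 : (0 < r1)%E).

(** From here on all weights are functions of x = ln t. [B x] stands for the norm over (0, e^x), and
    [rho x] below for the function rho of the theorem at e^x. *)
Let al x := a0 (expR x).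
Let be x := b0 (expR x) / a0 (expR x).
Let ga x := b1 (expR x).
Let c x := al x * B x.

Hypotheses (ha0 : regvar al 0) (hb0 : regvar (fun x => b0 (expR x)) 0).
Hypotheses (hb1 : regvar ga 0) (hB : regvar B 0).
Hypothesis B_initial : exists2 C : R, 0 < C & forall i : int,
  ((B i%:~R)%:E <= C%:E * lq r0 (initial i (fun j => (be j%:~R)%:E)))%E /\
  (lq r0 (initial i (fun j => (be j%:~R)%:E)) <= (C * B i%:~R)%:E)%E.

Let rho x := expR ((theta1 - theta0) * x) * (c x / ga x).
Let X := interpR A0 A1 theta0 r0 b0 q0 a0.
Let Y := interp A0 A1 theta1 r1 b1.
Let K f u := Kfun A0 A1 u f.
Let k := Klog A0 A1.
Let sumA := sum_space A0 A1.

Lemma regvar_scale : regvar rho (theta1 - theta0).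
Proof.
have := regvarM (regvar_expR (theta1 - theta0))
  (regvarM (regvarM ha0 hB) (regvarV hb1)).
by rewrite oppr0 !addr0.
Qed.

Let al0 x : 0 < al x. Proof. exact: regvar_gt0 ha0. Qed.
Let ga0 x : 0 < ga x. Proof. exact: regvar_gt0 hb1. Qed.
Let B0 x : 0 < B x. Proof. exact: regvar_gt0 hB. Qed.
Let c_gt0 x : 0 < c x. Proof. exact: mulr_gt0. Qed.
Let hbe : regvar be 0.
Proof. by have := regvarM hb0 (regvarV ha0); rewrite oppr0 addr0. Qed.
Let be0 x : 0 < be x. Proof. exact: regvar_gt0 hbe. Qed.
Let rho0 x : 0 < rho x. Proof. exact: regvar_gt0 regvar_scale. Qed.

(** * Estimates in the two endpoint spaces *)

Lemma norm_finite_interpR : norm_finite X.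
Proof. by move=> f [_ fX]; rewrite fX andbT; exact: Lnorm_ge0. Qed.

Lemma norm_finite_interp : norm_finite Y.
Proof. by move=> f [_ fY]; rewrite fY andbT; exact: Lnorm_ge0. Qed.

Lemma KfunA_Kshape f : Kshape (fun x => K f (expR x)).
Proof. by apply: Kfun_Kshape; exact: quasi_normed_finite. Qed.

Lemma weightedE theta b f j : sumA f ->
  weighted theta b (K f) j = (expR (- theta * j%:~R) * b (expR j%:~R) * k j%:~R f)%:E.
Proof. by move=> hf; rewrite /weighted /K KlogE// -EFinM. Qed.

Let k_ge0 x f : 0 <= k x f. Proof. exact: Klog_ge0. Qed.

(** For every [i <= j] the inner norm over the tail from [i] is at least its term at [j]. This term
    leaves the outer norm as a factor, and the outer weights over [i <= j] add up to [B j]. *)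
Lemma Klog_le_interpR : exists2 C : R, 0 < C & forall f (j : int), sumA f ->
  ((expR (- theta0 * j%:~R) * c j%:~R * k j%:~R f)%:E <= C%:E * qnorm X f)%E.
Proof.
have [C1 C10 hC1] := interpR_norm_dyadic theta0 q0_gt0 r0_gt0 ha0 hb0.
have [C2 C20 hC2] := B_initial.
exists (C2 * C1) => [|f j hf]; first exact: mulr_gt0.
have [_ low] := hC1 _ (KfunA_Kshape f).
set w := weighted theta0 a0 (K f) in low.
have w0 : forall j, (0 <= w j)%E := weighted_ge0 theta0 ha0 (KfunA_Kshape f).
have T0 i : (0 <= lq q0 (tail i w))%E by apply: lq_ge0 => //; exact: tail_ge0.
have ini0 i : (0 <= initial j (fun j => (be j%:~R)%:E) i)%E.
  by apply: initial_ge0 => l; rewrite lee_fin ltW.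
pose m := expR (- theta0 * j%:~R) * al j%:~R * k j%:~R f.
have m0 : 0 <= m by rewrite !mulr_ge0 ?expR_ge0 ?k_ge0// ltW.
have qX0 : (0 <= qnorm X f)%E by exact: Lnorm_ge0.
have -> : expR (- theta0 * j%:~R) * c j%:~R * k j%:~R f = m * B j%:~R.
  by rewrite /m /c; ring.
move: m0; rewrite le_eqVlt => /predU1P[<-|m0].
  by rewrite mul0r mule_ge0// lee_fin mulr_ge0// ltW.
rewrite EFinM; have [BC _] := hC2 j.
apply: (@le_trans _ _ (m%:E * (C2%:E * lq r0 (initial j (fun j => (be j%:~R)%:E))))%E).
  by rewrite lee_pmul2l// lte_fin.
rewrite muleCA (EFinM C2) -muleA lee_pmul2l// -lqZ//.
apply: le_trans low; apply: lq_le => // [i|i].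
  by rewrite mule_ge0// lee_fin ltW.
rewrite /initial; case: ifPn => ij; last first.
  by rewrite mule0 mule_ge0// lee_fin ltW// be0.
rewrite muleC; apply: lee_wpmul2l; first by rewrite lee_fin ltW// be0.
apply: (@le_trans _ _ (tail i w j)).
  by rewrite /tail ij /w weightedE.
by apply: lq_ge_term => //; exact: tail_ge0.
Qed.

(** If the weighted K-functional is a bump around [i], the inner norms are of order [m] up to [i]
    and decay afterwards. The outer weights up to [i] then give [B i], and the later ones add only a
    multiple of this. *)
Lemma interpR_bump e : 0 < e -> exists2 C : R, 0 < C &
  forall f (i : int) m, sumA f -> 0 < m ->
  (forall j : int, expR (- theta0 * j%:~R) * al j%:~R * k j%:~R f <=
     m * expR (- e * `|j%:~R - i%:~R|)) ->
  (qnorm X f <= (C * (m * B i%:~R))%:E)%E.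
Proof.
move=> e0.
have [C1 C10 hC1] := interpR_norm_dyadic theta0 q0_gt0 r0_gt0 ha0 hb0.
have [C2 C20 hC2] := B_initial.
have [C3 C30 hC3] := lq_bump q0_gt0 e0.
have e20 : 0 < e / 2 by rewrite divr_gt0.
have [C4 C40 hC4] := hbe.2 _ e20.
have [C5 C50 hC5] := lq_schur_id r0_gt0 e20 (ltr_wpDr (ltW C40) ltr01).
exists (C1 * (C3 * (C5 * C2))) => [|f i m hf m_gt0 hm]; first by rewrite !mulr_gt0.
have m0 := ltW m_gt0.
have [up _] := hC1 _ (KfunA_Kshape f); set w := weighted theta0 a0 (K f) in up.
have w0 : forall j, (0 <= w j)%E := weighted_ge0 theta0 ha0 (KfunA_Kshape f).
apply: le_trans up _.
rewrite -mulrA EFinM; apply: lee_wpmul2l; first by rewrite lee_fin ltW.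
have tail_le (l : int) :
    (lq q0 (tail l w) <= (C3 * m * (if i <= l then expR (- e * (l%:~R - i%:~R)) else 1))%:E)%E.
  (* A tail starting to the right of [i] is a bump centred at its own start [l], lowered by the
     factor e^(-e(l - i)). *)
  pose h := if i <= l then expR (- e * (l%:~R - i%:~R)) else 1.
  pose i' := if i <= l then l else i.
  have h0 : 0 <= h by rewrite /h; case: ifP.
  rewrite -/h -mulrA EFinM; apply: (hC3 _ _ i').
  - exact: tail_ge0.
  - by rewrite lee_fin mulr_ge0.
  move=> j; rewrite /tail; case: ifPn => lj; last first.
    by rewrite mule_ge0// lee_fin ?expR_ge0// mulr_ge0.
  rewrite /w weightedE// -EFinM lee_fin; apply: le_trans (hm j) _.
  rewrite mulrCA; apply: ler_wpM2l => //; rewrite /h /i'; case: ifPn => il.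
    rewrite -expRD ler_expR !ger0_norm ?subr_ge0 ?ler_int//; first lra.
    exact: le_trans lj.
  by rewrite mulr1.
(* Indices up to [i] are compared with themselves and later ones with [i]: there the inner norms
   decay at rate [e] while [be] grows at rate at most [e / 2]. *)
pose y j := ((C3 * m)%:E * initial i (fun j => (be j%:~R)%:E) j)%E.
have y0 j : (0 <= y j)%E.
  rewrite mule_ge0 ?lee_fin ?mulr_ge0 ?(ltW C30)//.
  by apply: initial_ge0 => l; rewrite lee_fin ltW.
apply: (@le_trans _ _ (C5%:E * lq r0 y)%E).
  apply: hC5 => // [l|l].
    rewrite mule_ge0 ?lee_fin ?(ltW (be0 _))//.
    by apply: lq_ge0 => //; exact: tail_ge0.
  have X0 : 0 <= 1 + C4 by rewrite addr_ge0// ltW.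
  have Y0 : 0 <= C3 * m by rewrite mulr_ge0// ltW.
  have [il|li] := leP i l; last first.
    exists l; rewrite subrr normr0 mulr0 expR0 mulr1 /y /initial (ltW li).
    apply: (@le_trans _ _ ((be l%:~R)%:E * (C3 * m)%:E)%E).
      apply: lee_wpmul2l; first by rewrite lee_fin ltW// be0.
      by have := tail_le l; rewrite (lt_geF li) mulr1.
    rewrite muleC -[leLHS]mul1e lee_wpmul2r//.
      by rewrite mule_ge0// lee_fin ltW// be0.
    by rewrite lee_fin lerDl ltW.
  exists i; rewrite /y /initial lexx.
  apply: (@le_trans _ _ ((be l%:~R)%:E * (C3 * m * expR (- e * (l%:~R - i%:~R)))%:E)%E).
    apply: lee_wpmul2l; first by rewrite lee_fin ltW// be0.
    by have := tail_le l; rewrite il.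
  rewrite -!EFinM lee_fin mulrCA mulrA [leRHS]mulrCA -[leLHS]mulrA.
  apply: ler_wpM2l => //.
  apply: (@le_trans _ _ (expR (- e * (l%:~R - i%:~R)) * 
     (C4 * expR (0 * (l%:~R - i%:~R) + e / 2 * `|l%:~R - i%:~R|) * be i%:~R))).
    by rewrite mulrC ler_wpM2l ?expR_ge0.
  rewrite mulrA; apply: ler_wpM2r; first exact: ltW (be0 _).
  rewrite mulrCA -expRD; apply: ler_pM => //; try exact: ltW.
    by rewrite lerDr.
  rewrite ler_expR ger0_norm ?subr_ge0 ?ler_int//; lra.
have [_ BC] := hC2 i.
rewrite lqZ ?mulr_gt0//; last by apply: initial_ge0 => l; rewrite lee_fin ltW.
apply: (@le_trans _ _ (C5%:E * ((C3 * m)%:E * (C2 * B i%:~R)%:E))%E).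
  by rewrite !lee_wpmul2l// lee_fin ?mulr_ge0// ltW.
by rewrite -!EFinM lee_fin le_eqVlt; apply/orP; left; apply/eqP; ring.
Qed.

(** * The two Holmstedt estimates *)

Definition Ktail f (i : int) : \bar R :=
  lq r1 (tail i (weighted theta1 b1 (K f))).

Lemma Ktail_ge0 f i : (0 <= Ktail f i)%E.
Proof.
apply: lq_ge0 => //; apply: tail_ge0.
exact: weighted_ge0 hb1 (KfunA_Kshape f).
Qed.

Lemma sum_space_endpoints f : sum_space X Y f -> sumA f.
Proof. by move=> [f0 [f1 [[h0 _] [h1 _] ->]]]; exact: sum_spaceD. Qed.

Lemma Ktail_le_Kfun : exists2 C : R, 0 < C & forall (i : int) f,
  sum_space X Y f ->
  ((rho i%:~R)%:E * Ktail f i <= C%:E * Kfun X Y (rho i%:~R) f)%E.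
Proof.
have [CX CX0 hCX] := Klog_le_interpR.
have [CK CK0 hCK] := KlogD qA0 qA1.
pose d := (theta1 - theta0) / 2; have d0 : 0 < d by rewrite divr_gt0// subr_gt0.
have [Cr Cr0 hCr] : exists2 C, 0 < C & forall x y, x <= y ->
    (rho y)^-1 <= C * expR (- d * (y - x)) * (rho x)^-1.
  apply: (regvar_decay (regvarV regvar_scale)); rewrite ltrN2 /d. have := theta01; lra.
have [Cb Cb0 hCb] := lq_bump r1_gt0 d0.
have [CD CD0 hCD] := lqD r1_gt0.
have [CY CY0 hCY] := interp_norm_dyadic theta1 r1_gt0 hb1.
pose C := CK * CD * (Cb * (CX * Cr) + CY).
have C0 : 0 < C by rewrite !mulr_gt0// addr_gt0 ?mulr_gt0.
exists C => // i f hf; have hAf := sum_space_endpoints hf.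
rewrite -lee_pdivrMl//.
apply: le_ereal_inf_tmp => _ [g0 [g1 [Xg0 Yg1 fE ->]]].
have sg0 : sumA g0 by case: Xg0.
have sg1 : sumA g1 by case: Yg1.
have /andP[n00 n0y] := norm_finite_interpR Xg0.
have /andP[n10 n1y] := norm_finite_interp Yg1.
have n0E : qnorm X g0 = (fine (qnorm X g0))%:E by rewrite fineK// ge0_fin_numE.
have n1E : qnorm Y g1 = (fine (qnorm Y g1))%:E by rewrite fineK// ge0_fin_numE.
set n0 := fine (qnorm X g0) in n0E; set n1 := fine (qnorm Y g1) in n1E.
have m0 : 0 <= n0 by rewrite fine_ge0.
have m1 : 0 <= n1 by rewrite fine_ge0.
have r_gt0 := rho0 i%:~R; set r := rho i%:~R in r_gt0 *.
pose M := CX * Cr * n0 / r.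
have M0 : 0 <= M by rewrite /M !mulr_ge0 ?invr_ge0 ?(ltW CX0) ?(ltW Cr0) ?(ltW r_gt0).
pose P j : \bar R := ((expR (- d * `|j%:~R - i%:~R|))%:E * M%:E)%E.
have P0 j : (0 <= P j)%E by rewrite mule_ge0// lee_fin expR_ge0.
have w0 g : forall j, (0 <= weighted theta1 b1 (K g) j)%E.
  exact: weighted_ge0 hb1 (KfunA_Kshape g).
have hle : (Ktail f i <= CK%:E * (CD%:E * (Cb%:E * M%:E + CY%:E * n1%:E)))%E.
  apply: (@le_trans _ _ (lq r1 (fun j => CK%:E * (P j + weighted theta1 b1 (K g1) j))%E)).
    apply: lq_le => // [j|j]; first exact: tail_ge0.
    rewrite /tail; case: ifPn => ij; last first.
      by rewrite mule_ge0 ?adde_ge0// lee_fin ltW.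
    rewrite !weightedE// (_ : P j = (expR (- d * `|j%:~R - i%:~R|) * M)%:E)//.
    rewrite -EFinD -EFinM lee_fin -/(ga _).
    apply: (@le_trans _ _ (expR (- theta1 * j%:~R) * ga j%:~R *
        (CK * (k j%:~R g0 + k j%:~R g1)))).
      apply: ler_wpM2l; first by rewrite mulr_ge0 ?expR_ge0 ?(ltW (ga0 _)).
      by rewrite fE; exact: hCK.
    rewrite mulrCA; apply: ler_wpM2l; first exact: ltW.
    rewrite mulrDr lerD2r.
    (* By the definition of [rho], passing from the theta1-weight to the theta0-weight is division
       by [rho]. *)
    have -> : expR (- theta1 * j%:~R) * ga j%:~R * k j%:~R g0 =
        expR (- theta0 * j%:~R) * c j%:~R * k j%:~R g0 * (rho j%:~R)^-1.
      rewrite /rho invfM invf_div -expRN.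
      have -> : - theta1 * j%:~R = - theta0 * j%:~R + - ((theta1 - theta0) * j%:~R) :> R.
        by ring.
      by rewrite expRD; field; rewrite gt_eqF// c_gt0.
    apply: (@le_trans _ _ (CX * n0 * (Cr * expR (- d * (j%:~R - i%:~R)) * r^-1))).
      apply: ler_pM.
      - by apply: mulr_ge0; [apply: mulr_ge0; [exact: expR_ge0|exact: ltW (c_gt0 _)]|exact: k_ge0].
      - by rewrite invr_ge0 ltW ?rho0.
      - by rewrite -lee_fin (EFinM CX) -n0E; exact: hCX.
      - by apply: hCr; rewrite ler_int.
    rewrite /M ger0_norm ?subr_ge0 ?ler_int// le_eqVlt; apply/orP; left; apply/eqP.
    by ring.
  rewrite lqZ// => [|j]; last by rewrite adde_ge0.
  apply: lee_wpmul2l; first by rewrite lee_fin ltW.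
  apply: le_trans (hCD _ _ P0 (w0 g1)) _.
  apply: lee_wpmul2l; first by rewrite lee_fin ltW.
  apply: leeD; first exact: (hCb P M%:E i P0).
  have [_ + _ _] := hCY _ (KfunA_Kshape g1); move=> /le_trans; apply.
  by rewrite -n1E.
rewrite lee_pdivrMl// n0E n1E.
apply: (@le_trans _ _ (r%:E * (CK%:E * (CD%:E * (Cb%:E * M%:E + CY%:E * n1%:E))))%E).
  by apply: lee_wpmul2l => //; rewrite lee_fin ltW.
rewrite -[leLHS]/((r * (CK * (CD * (Cb * M + CY * n1))))%:E).
rewrite -[leRHS]/((C * (n0 + r * n1))%:E) lee_fin /C /M.
have -> : r * (CK * (CD * (Cb * (CX * Cr * n0 / r) + CY * n1))) =
    CK * CD * (Cb * (CX * Cr) * n0 + CY * (r * n1)).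
  by field; rewrite gt_eqF.
rewrite -[leRHS]mulrA; apply: ler_wpM2l; first by rewrite mulr_ge0// ltW.
have t1 : 0 <= CY * n0 by rewrite mulr_ge0// ltW.
have t2 : 0 <= Cb * (CX * Cr) * (r * n1).
  apply: mulr_ge0; last exact: mulr_ge0 (ltW r_gt0) m1.
  by apply: mulr_ge0; [exact: ltW|exact: ltW (mulr_gt0 CX0 Cr0)].
rewrite -subr_ge0 [leRHS](_ : _ = CY * n0 + Cb * (CX * Cr) * (r * n1)); last by ring.
exact: addr_ge0.
Qed.

(** Take an almost optimal f = f0 + f1 in the couple (A0, A1) at u = e^i. The K-functional of f0 is
    at most [kap] everywhere and close to that of f to the left of [i]; for f1 the sides are
    exchanged. Up to the tail of f, both become bumps around [i]. The strict level [kap] exists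
    because the infimum need not be attained. *)
Lemma Kfun_le_Ktail_level eps : 0 < eps -> exists2 C : R, 0 < C &
  forall (i : int) f M kap, sumA f -> 0 < M ->
  (forall j : int, j <= i -> expR (- theta0 * j%:~R) * c j%:~R * k j%:~R f <=
     expR (- eps * (i%:~R - j%:~R)) * M) ->
  k i%:~R f < kap -> expR (- theta0 * i%:~R) * c i%:~R * kap <= M ->
  (Ktail f i < +oo)%E ->
  sum_space X Y f /\
  (Kfun X Y (rho i%:~R) f <= C%:E * (M%:E + (rho i%:~R)%:E * Ktail f i))%E.
Proof.
move=> eps0.
(* One rate below every gap: [theta0] makes f0 decay to the right, [1 - theta1] makes f1 decay to
   the left, and [2 * e <= eps] leaves decay at rate [e] after the slow variation of [B] is paid. *)
have [e [e0 e_eps e_theta1 e_theta0]] : exists e, [/\ 0 < e, 2 * e <= eps,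
    e < 1 - theta1 & e < theta0].
  have h1 : 0 < 1 - theta1 by rewrite subr_gt0.
  exists (Num.min eps (Num.min (1 - theta1) theta0) / 2).
  set m := Num.min _ _; have m0 : 0 < m by rewrite !lt_min eps0 h1 theta0_gt0.
  have : m <= eps by rewrite ge_min lexx.
  have : m <= 1 - theta1 by rewrite !ge_min lexx !orbT.
  have : m <= theta0 by rewrite !ge_min lexx !orbT.
  by move=> *; split; lra.
have [CG CG0 hCG] : exists2 C, 0 < C & forall x y, y <= x ->
    expR ((1 - theta0) * y) * al y <=
    C * expR (- e * (x - y)) * (expR ((1 - theta0) * x) * al x).
  apply: (regvar_incr (regvarM (regvar_expR (1 - theta0)) ha0)).
  by have := theta01; lra.
have [CH CH0 hCH] : exists2 C, 0 < C & forall x y, x <= y ->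
    expR (- theta0 * y) * al y <=
    C * expR (- e * (y - x)) * (expR (- theta0 * x) * al x).
  by apply: (regvar_decay (regvarM (regvar_expR (- theta0)) ha0)); lra.
have [CG1 CG10 hCG1] : exists2 C, 0 < C & forall x y, y <= x ->
    expR ((1 - theta1) * y) * ga y <=
    C * expR (- e * (x - y)) * (expR ((1 - theta1) * x) * ga x).
  by apply: (regvar_incr (regvarM (regvar_expR (1 - theta1)) hb1)); lra.
have [CH1 CH10 hCH1] : exists2 C, 0 < C & forall x y, x <= y ->
    expR (- theta1 * y) * ga y <=
    C * expR (- e * (y - x)) * (expR (- theta1 * x) * ga x).
  apply: (regvar_decay (regvarM (regvar_expR (- theta1)) hb1)).
  by have := theta01; lra.
have [CB CB0 hCB] := hB.2 e e0.
have [CK CK0 hCK] := KlogD qA0 qA1.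
have [CX CX0 hCX] := interpR_bump e0.
have [CY CY0 hCY] := interp_norm_dyadic theta1 r1_gt0 hb1.
have [Cb Cb0 hCb] := lq_bump r1_gt0 e0.
have [CD CD0 hCD] := lqD r1_gt0.
pose CA := CK * (CB + CG) + CH; have CA0 : 0 < CA.
  by rewrite addr_gt0// mulr_gt0// addr_gt0.
pose CB1 := CG1 + CK * CH1; have CB10 : 0 < CB1.
  by rewrite addr_gt0// mulr_gt0.
pose C := CX * CA + CY * CD * (CK + Cb * CB1).
have C0 : 0 < C by rewrite addr_gt0 ?mulr_gt0// addr_gt0// mulr_gt0.
exists C => // i f M kap hf M0 hM kkap kapM Qfin.
set I : R := i%:~R in hM kkap kapM *.
have kap0 : 0 < kap by exact: le_lt_trans (k_ge0 _ _) kkap.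
have /ereal_inf_lt[_ [f0 [f1 [A0f0 A1f1 fE ->]]] hlt] :
    (Kfun A0 A1 (expR I) f < kap%:E)%E by rewrite KlogE// lte_fin.
have sf0 : sumA f0 by exact: sum_space_left.
have sf1 : sumA f1 by exact: sum_space_right.
have /andP[n00 n0y] := quasi_normed_finite qA0 A0f0.
have /andP[n10 n1y] := quasi_normed_finite qA1 A1f1.
have n0E : qnorm A0 f0 = (fine (qnorm A0 f0))%:E by rewrite fineK// ge0_fin_numE.
have n1E : qnorm A1 f1 = (fine (qnorm A1 f1))%:E by rewrite fineK// ge0_fin_numE.
set n0 := fine (qnorm A0 f0) in n0E; set n1 := fine (qnorm A1 f1) in n1E.
have m0 : 0 <= n0 by rewrite fine_ge0.
have m1 : 0 <= n1 by rewrite fine_ge0.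
move: hlt; rewrite n0E n1E -EFinM -EFinD lte_fin => hlt.
have n0kap : n0 <= kap.
  by apply: le_trans (ltW hlt); rewrite lerDl mulr_ge0 ?expR_ge0.
have n1kap : expR I * n1 <= kap by apply: le_trans (ltW hlt); rewrite lerDr.
have n1kap' x : expR x * n1 <= expR (x - I) * kap.
  have -> : expR x = expR (x - I) * expR I by rewrite -expRD subrK.
  by rewrite -mulrA ler_wpM2l ?expR_ge0.
have [A0Nf0 n0N] := carrierN qA0 A0f0; have [A1Nf1 n1N] := carrierN qA1 A1f1.
have k0_kap x : k x f0 <= kap by exact: le_trans (Klog_left qA0 qA1 x A0f0) _.
have k1_kap x : k x f1 <= expR (x - I) * kap.
  exact: le_trans (Klog_right qA0 qA1 x A1f1) (n1kap' x).
have k0_f x : k x f0 <= CK * (k x f + expR (x - I) * kap).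
  have -> : f0 = f + - f1 by rewrite fE addrK.
  apply: le_trans (hCK x _ _ hf (sum_space_right qA0 A1Nf1)) _.
  rewrite ler_pM2l// lerD2l; apply: le_trans (Klog_right qA0 qA1 x A1Nf1) _.
  by rewrite n1N.
have k1_f x : k x f1 <= CK * (k x f + kap).
  have -> : f1 = f + - f0 by rewrite fE addrC addKr.
  apply: le_trans (hCK x _ _ hf (sum_space_left qA1 A0Nf0)) _.
  rewrite ler_pM2l// lerD2l; apply: le_trans (Klog_left qA0 qA1 x A0Nf0) _.
  by rewrite n0N.
have kapB : expR (- theta0 * I) * al I * kap <= M / B I.
  by rewrite ler_pdivlMr//; apply: le_trans kapM; rewrite /c le_eqVlt;
    apply/orP; left; apply/eqP; ring.
have MB0 : 0 <= M / B I by rewrite divr_ge0 ?ltW ?B0.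
(* Left of [i], f0 = f - f1: the f-part obeys the hypothesis on [M] divided by [B j], and the
   f1-part falls off like (u/t) [kap]. Right of [i], the constant bound [kap] meets the decaying
   weight. *)
have claimA (j : int) : expR (- theta0 * j%:~R) * al j%:~R * k j%:~R f0 <=
    CA * (M / B I) * expR (- e * `|j%:~R - I|).
  have al_ge0 : 0 <= expR (- theta0 * j%:~R) * al j%:~R.
    by rewrite mulr_ge0 ?expR_ge0 ?(ltW (al0 _)).
  have E0 : 0 <= expR (- e * `|j%:~R - I|) by exact: expR_ge0.
  have [ji|/ltW ij] := leP j i.
    have jI : (j%:~R : R) <= I by rewrite ler_int.
    apply: (@le_trans _ _ (CK * ((CB + CG) * (M / B I) * expR (- e * `|j%:~R - I|)))); last first.
      have -> : CK * ((CB + CG) * (M / B I) * expR (- e * `|j%:~R - I|)) =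
        CK * (CB + CG) * (M / B I) * expR (- e * `|j%:~R - I|) by ring.
      by apply: ler_wpM2r => //; apply: ler_wpM2r => //; rewrite /CA lerDl ltW.
    apply: le_trans (ler_wpM2l al_ge0 (k0_f _)) _.
    rewrite mulrCA ler_pM2l// mulrDr -mulrA mulrDl; apply: lerD.
      have -> : expR (- theta0 * j%:~R) * al j%:~R * k j%:~R f =
          expR (- theta0 * j%:~R) * c j%:~R * k j%:~R f / B j%:~R.
        by rewrite /c; field; rewrite gt_eqF.
      apply: le_trans (ler_wpM2r _ (hM j ji)) _; first by rewrite invr_ge0 ltW.
      have := hCB j%:~R I; rewrite mul0r add0r => hBB.
      rewrite ler_pdivrMr//.
      apply: (@le_trans _ _ (expR (- eps * (I - j%:~R)) * (M / B I) * B I)).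
        by rewrite -mulrA divfK ?gt_eqF.
      apply: le_trans (ler_wpM2l _ hBB) _; first by rewrite mulr_ge0 ?expR_ge0.
      have -> : expR (- eps * (I - j%:~R)) * (M / B I) *
          (CB * expR (e * `|I - j%:~R|) * B j%:~R) =
          CB * (M / B I) * (expR (- eps * (I - j%:~R)) * expR (e * `|I - j%:~R|)) * B j%:~R.
        by ring.
      rewrite ler_pM2r// [leRHS]mulrA; apply: ler_wpM2l.
        by rewrite mulr_ge0 ?(ltW CB0).
      rewrite -expRD ler_expR.
      rewrite (distrC j%:~R) ger0_norm ?subr_ge0//.
      have : 0 <= (eps - 2 * e) * (I - j%:~R) by rewrite mulr_ge0 ?subr_ge0.
      lra.
    have -> : expR (- theta0 * j%:~R) * al j%:~R * (expR (j%:~R - I) * kap) =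
        expR ((1 - theta0) * j%:~R) * al j%:~R * (expR (- I) * kap).
      have -> : (1 - theta0) * j%:~R = - theta0 * j%:~R + j%:~R by ring.
      by rewrite !expRD; ring.
    apply: le_trans (ler_wpM2r _ (hCG _ _ jI)) _; first by rewrite mulr_ge0 ?expR_ge0 ?(ltW kap0).
    rewrite (distrC j%:~R) ger0_norm ?subr_ge0//.
    have -> : CG * expR (- e * (I - j%:~R)) * (expR ((1 - theta0) * I) * al I) *
        (expR (- I) * kap) =
        CG * (expR (- theta0 * I) * al I * kap) * expR (- e * (I - j%:~R)).
      have -> : (1 - theta0) * I = - theta0 * I + I by ring.
      by rewrite expRD -[X in _ = _ * (X * _ * _) * _]mulr1 -(expR0 R) -(subrr I) expRD; ring.
    by rewrite [leRHS]mulrA ler_wpM2r ?expR_ge0// ler_pM2l.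
  have jI : I <= j%:~R by rewrite ler_int.
  apply: le_trans (ler_wpM2l al_ge0 (k0_kap _)) _.
  apply: le_trans (ler_wpM2r (ltW kap0) (hCH _ _ jI)) _.
  rewrite ger0_norm ?subr_ge0//.
  have -> : CH * expR (- e * (j%:~R - I)) * (expR (- theta0 * I) * al I) * kap =
      CH * (expR (- theta0 * I) * al I * kap) * expR (- e * (j%:~R - I)) by ring.
  rewrite ler_wpM2r ?expR_ge0//; apply: ler_pM => //.
  - exact: ltW.
  - by rewrite !mulr_ge0 ?expR_ge0 ?(ltW kap0) ?(ltW (al0 _)).
  - by rewrite /CA lerDr mulr_ge0 ?addr_ge0// ltW.
have Xf0 : (qnorm X f0 <= (CX * (CA * M))%:E)%E.
  apply: le_trans (hCX f0 i (CA * (M / B I)) sf0 _ claimA) _.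
    by rewrite mulr_gt0// divr_gt0 ?B0.
  by rewrite lee_fin ler_pM2l// -mulrA divfK ?gt_eqF ?B0.
have rI0 := rho0 I.
have kapr : expR (- theta1 * I) * ga I * kap <= M / rho I.
  rewrite ler_pdivlMr//; apply: le_trans kapM.
  rewrite /rho le_eqVlt; apply/orP; left; apply/eqP.
  have -> : - theta0 * I = - theta1 * I + (theta1 - theta0) * I by ring.
  by rewrite expRD; field; rewrite gt_eqF ?ga0.
have Mr0 : 0 <= M / rho I by rewrite divr_ge0 ?(ltW rI0) ?(ltW M0).
pose P j : \bar R := ((expR (- e * `|j%:~R - I|))%:E * (CB1 * (M / rho I))%:E)%E.
have P0 j : (0 <= P j)%E by rewrite mule_ge0// lee_fin ?expR_ge0// mulr_ge0// ltW.
pose T j := (CK%:E * tail i (weighted theta1 b1 (K f)) j)%E.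
have w0 g : forall j, (0 <= weighted theta1 b1 (K g) j)%E.
  exact: weighted_ge0 hb1 (KfunA_Kshape g).
have T0 j : (0 <= T j)%E.
  by rewrite mule_ge0 ?tail_ge0// lee_fin ltW.
(* Right of [i], f1 = f - f0 yields the tail of f plus the constant [kap] under a decaying weight.
   Left of [i], the bound (u/t) [kap] suffices since [theta1 < 1]. *)
have claimB j : (weighted theta1 b1 (K f1) j <= T j + P j)%E.
  have ga_ge0 : 0 <= expR (- theta1 * j%:~R) * ga j%:~R.
    by rewrite mulr_ge0 ?expR_ge0 ?(ltW (ga0 _)).
  have PE : P j = (expR (- e * `|j%:~R - I|) * (CB1 * (M / rho I)))%:E by [].
  rewrite weightedE//; have [ij|ji] := leP i j.
    have jI : I <= j%:~R by rewrite ler_int.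
    rewrite /T /tail ij weightedE// PE -EFinM -EFinD lee_fin -/(ga _).
    apply: le_trans (ler_wpM2l ga_ge0 (k1_f _)) _.
    rewrite mulrCA mulrDr mulrDr; apply: lerD => //.
    apply: le_trans (ler_wpM2l (ltW CK0) (ler_wpM2r (ltW kap0) (hCH1 _ _ jI))) _.
    rewrite ger0_norm ?subr_ge0//.
    have -> : CK * (CH1 * expR (- e * (j%:~R - I)) * (expR (- theta1 * I) * ga I) * kap) =
      expR (- e * (j%:~R - I)) * ((CK * CH1) * (expR (- theta1 * I) * ga I * kap)) by ring.
    rewrite ler_wpM2l ?expR_ge0//; apply: ler_pM => //.
    - by rewrite mulr_ge0 ?(ltW CK0) ?(ltW CH10).
    - by rewrite !mulr_ge0 ?expR_ge0 ?(ltW kap0) ?(ltW (ga0 _)).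
    - by rewrite /CB1 lerDr ltW.
  have jI : (j%:~R : R) <= I by rewrite ler_int ltW.
  rewrite -[leLHS]add0e; apply: leeD => //; rewrite PE lee_fin.
  apply: le_trans (ler_wpM2l ga_ge0 (k1_kap _)) _.
  have -> : expR (- theta1 * j%:~R) * ga j%:~R * (expR (j%:~R - I) * kap) =
      expR ((1 - theta1) * j%:~R) * ga j%:~R * (expR (- I) * kap).
    have -> : (1 - theta1) * j%:~R = - theta1 * j%:~R + j%:~R by ring.
    by rewrite !expRD; ring.
  apply: le_trans (ler_wpM2r _ (hCG1 _ _ jI)) _; first by rewrite mulr_ge0 ?expR_ge0 ?(ltW kap0).
  rewrite (distrC j%:~R) ger0_norm ?subr_ge0//.
  have -> : CG1 * expR (- e * (I - j%:~R)) * (expR ((1 - theta1) * I) * ga I) *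
      (expR (- I) * kap) =
      expR (- e * (I - j%:~R)) * (CG1 * (expR (- theta1 * I) * ga I * kap)).
    have -> : (1 - theta1) * I = - theta1 * I + I by ring.
    rewrite expRD -[X in _ = _ * (_ * (X * _ * _))]mulr1 -(expR0 R) -(subrr I) expRD; ring.
  rewrite ler_wpM2l ?expR_ge0//; apply: ler_pM => //.
  - exact: ltW.
  - by rewrite !mulr_ge0 ?expR_ge0 ?(ltW kap0) ?(ltW (ga0 _)).
  - by rewrite /CB1 lerDl mulr_ge0// ltW.
have Yf1 : (qnorm Y f1 <= (CY * CD)%:E *
    (CK%:E * Ktail f i + (Cb * (CB1 * (M / rho I)))%:E))%E.
  have [up _ _ _] := hCY _ (KfunA_Kshape f1).
  apply: le_trans up _; rewrite EFinM -muleA.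
  apply: lee_wpmul2l; first by rewrite lee_fin ltW.
  apply: le_trans (lq_le r1_gt0 (w0 f1) claimB) _.
  apply: le_trans (hCD _ _ T0 P0) _.
  apply: lee_wpmul2l; first by rewrite lee_fin ltW.
  apply: leeD; first by rewrite lqZ//; exact: tail_ge0.
  rewrite EFinM; apply: (hCb P _ i P0) => //.
  by rewrite lee_fin mulr_ge0// ltW.
have Qge0 := Ktail_ge0 f i.
have QE : Ktail f i = (fine (Ktail f i))%:E by rewrite fineK// ge0_fin_numE.
have Xcf0 : carrier X f0 by split => //; apply: le_lt_trans Xf0 _; rewrite ltry.
have Ycf1 : carrier Y f1.
  by split => //; apply: le_lt_trans Yf1 _; rewrite QE; exact: ltry.
split; first by exists f0, f1.
rewrite fE; apply: le_trans (Kfun_le _ Xcf0 Ycf1) _.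
apply: le_trans (leeD Xf0 (lee_wpmul2l _ Yf1)) _; first by rewrite lee_fin ltW.
rewrite -fE QE; set Q := fine _.
have Q0 : 0 <= Q by rewrite fine_ge0.
rewrite -[leLHS]/((CX * (CA * M) +
  rho I * (CY * CD * (CK * Q + Cb * (CB1 * (M / rho I)))))%:E).
rewrite -[leRHS]/((C * (M + rho I * Q))%:E) lee_fin /C.
have -> : CX * (CA * M) + rho I * (CY * CD * (CK * Q + Cb * (CB1 * (M / rho I)))) =
  (CX * CA + CY * CD * (Cb * CB1)) * M + CY * CD * CK * (rho I * Q).
  by field; rewrite gt_eqF.
have h1 : 0 <= CY * CD * CK * M by rewrite !mulr_ge0// ltW.
have h2 : 0 <= (CX * CA + CY * CD * (Cb * CB1)) * (rho I * Q).
  apply: mulr_ge0; last exact: mulr_ge0 (ltW rI0) Q0.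
  by rewrite addr_ge0 ?mulr_ge0// ltW.
rewrite -subr_ge0 [leRHS](_ : _ = CY * CD * CK * M +
  (CX * CA + CY * CD * (Cb * CB1)) * (rho I * Q)); last by ring.
exact: addr_ge0.
Qed.

(** Limit of the previous lemma: [M] is raised to [M + eta], and [kap] is the level at which the
    weight equals [M + eta], strictly above the K-functional. *)
Lemma Kfun_le_Ktail eps : 0 < eps -> exists2 C : R, 0 < C &
  forall (i : int) f M, sumA f -> 0 <= M ->
  (forall j : int, j <= i -> expR (- theta0 * j%:~R) * c j%:~R * k j%:~R f <=
     expR (- eps * (i%:~R - j%:~R)) * M) ->
  (Ktail f i < +oo)%E ->
  sum_space X Y f /\
  (Kfun X Y (rho i%:~R) f <= C%:E * (M%:E + (rho i%:~R)%:E * Ktail f i))%E.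
Proof.
move=> eps0; have [C C0 hC] := Kfun_le_Ktail_level eps0.
exists C => // i f M hf M0 hM Qfin.
have W0 : 0 < expR (- theta0 * i%:~R) * c i%:~R by rewrite mulr_gt0 ?expR_gt0 ?c_gt0.
have step (eta : R) : 0 < eta -> sum_space X Y f /\
    (Kfun X Y (rho i%:~R) f <= C%:E * ((M + eta)%:E + (rho i%:~R)%:E * Ktail f i))%E.
  move=> eta0; have Me0 : 0 < M + eta by rewrite ltr_wpDl.
  apply: (hC i f (M + eta) ((M + eta) / (expR (- theta0 * i%:~R) * c i%:~R))) => //.
  - by move=> j ji; apply: le_trans (hM j ji) _; rewrite ler_wpM2l ?expR_ge0// lerDl ltW.
  - rewrite ltr_pdivlMr// mulrC; apply: le_lt_trans (hM i (lexx _)) _.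
    by rewrite subrr mulr0 expR0 mul1r ltrDl.
  - by rewrite mulrC divfK ?gt_eqF.
have [sXY _] := step 1 ltr01; split => //.
apply/lee_addgt0Pr => eta eta0.
have [_] := step (eta / C) (divr_gt0 eta0 C0) => /le_trans; apply.
rewrite EFinD addeAC ge0_muleDr//; last 2 first.
- by rewrite adde_ge0// mule_ge0 ?Ktail_ge0// lee_fin ltW.
- by rewrite lee_fin divr_ge0// ltW.
by rewrite -EFinM mulrC divfK ?gt_eqF.
Qed.

(** * The outer norm and the Hardy inequalities *)

Variables (theta : R) (r : \bar R) (a : R -> R).
Hypotheses (theta_gt0 : 0 < theta) (theta_le1 : theta <= 1) (r_gt0 : (0 < r)%E).
Hypothesis ha : regvar (fun x => a (expR x)) 0.

Let S f := interp_norm X Y theta r a f.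
Let A x := expR (- theta * x) * a (expR x).
(** The outer weight s^(-theta) a(s) at s = rho, that is, after the substitution. *)
Let W x := A (ln (rho x)).
Let N f (j : int) := expR (- theta0 * j%:~R) * c j%:~R * k j%:~R f.
Let lqT f := lq r (fun i => (W i%:~R * rho i%:~R)%:E * Ktail f i)%E.

Let delta_gt0 : 0 < theta1 - theta0. Proof. by rewrite subr_gt0. Qed.

(** [W] is rho^(-theta) times the slowly varying a(rho); its index is the source of both Hardy
    inequalities. *)
Lemma regvar_weight : regvar W (- (theta * (theta1 - theta0))).
Proof.
have := regvarM (regvarV (regvar_powR theta_gt0 regvar_scale))
  (regvar_comp ha regvar_scale).
rewrite addr0; congr regvar; apply/funext => x; rewrite /W /A; congr (_ * _).
by rewrite mulNr expRN mulrC expRM lnK// posrE; exact: rho0.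
Qed.

Let W0 x : 0 < W x. Proof. exact: regvar_gt0 regvar_weight. Qed.
Let N0 f j : 0 <= N f j.
Proof. by apply: mulr_ge0 (k_ge0 _ _); rewrite mulr_ge0 ?expR_ge0 ?ltW ?c_gt0. Qed.
Let Wrho0 x : 0 < W x * rho x. Proof. exact: mulr_gt0 (W0 x) (rho0 x). Qed.

Let scaleN f (j : int) :
  rho j%:~R * (expR (- theta1 * j%:~R) * ga j%:~R * k j%:~R f) = N f j.
Proof.
rewrite /rho /N; have -> : - theta0 * j%:~R =
  - theta1 * j%:~R + (theta1 - theta0) * j%:~R :> R by ring.
by rewrite expRD; field; rewrite gt_eqF ?ga0.
Qed.

Let N_le_Ktail f j : sumA f -> ((N f j)%:E <= (rho j%:~R)%:E * Ktail f j)%E.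
Proof.
move=> hf; rewrite -scaleN EFinM; apply: lee_wpmul2l.
  by rewrite lee_fin; exact: ltW (rho0 _).
have -> : (expR (- theta1 * j%:~R) * ga j%:~R * k j%:~R f)%:E =
    tail j (weighted theta1 b1 (K f)) j by rewrite /tail lexx weightedE.
apply: lq_ge_term => //; apply: tail_ge0.
exact: weighted_ge0 hb1 (KfunA_Kshape f).
Qed.

Let lqN_le_lqT f : sumA f ->
  (lq r (fun i => (W i%:~R * N f i)%:E) <= lqT f)%E.
Proof.
move=> hf; apply: lq_le => // i; first by rewrite lee_fin mulr_ge0// ltW.
rewrite EFinM [in leRHS]EFinM -muleA; apply: lee_wpmul2l; last exact: N_le_Ktail.
by rewrite lee_fin ltW.
Qed.

(* [lq_Nsup] applies to [j <= i] if [eps < theta * (theta1 - theta0)], because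
   then [W] decays faster than [expR (- eps * x)], and to [i <= j] if
   [theta * (theta1 - theta0) < eps]. *)
Let Nsup (P : int -> int -> bool) eps f (i : int) : \bar R :=
  ereal_sup [set (expR (eps * (i%:~R - j%:~R)) * N f j)%:E | j in [set j | P j i]].

Let Nsup_ub (P : int -> int -> bool) eps f i j : P j i ->
  ((expR (eps * (i%:~R - j%:~R)) * N f j)%:E <= Nsup P eps f i)%E.
Proof. by move=> Pji; apply: ereal_sup_ubound; exists j. Qed.

Let Nsup_ge0 (P : int -> int -> bool) eps f i : P i i -> (0 <= Nsup P eps f i)%E.
Proof.
move=> Pii; apply: le_trans (Nsup_ub eps f Pii).
by rewrite lee_fin mulr_ge0 ?expR_ge0.
Qed.

Let lq_Nsup (P : int -> int -> bool) eps e C : 0 < e -> 0 < C ->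
  (forall i, P i i) ->
  (forall i j : int, P j i -> W i%:~R * expR (eps * (i%:~R - j%:~R)) <=
     C * expR (- e * `|i%:~R - j%:~R|) * W j%:~R) ->
  exists2 D : R, 0 < D & forall f,
  (lq r (fun i => (W i%:~R)%:E * Nsup P eps f i)%E <=
    D%:E * lq r (fun i => (W i%:~R * N f i)%:E))%E.
Proof.
move=> e0 C0 Pii hW; have [D D0 hD] := lq_sup r_gt0 e0 C0.
exists D => // f; apply: (hD _ _ id) => i.
- by rewrite mule_ge0 ?Nsup_ge0// lee_fin ltW.
- by rewrite lee_fin mulr_ge0// ltW.
rewrite /Nsup -ereal_sup_pZl//.
apply: ge_ereal_sup => _ [_ [j Pji <-] <-].
apply: le_ereal_sup_tmp; eexists; first by exists j.
rewrite -!EFinM lee_fin mulrA [leRHS]mulrA.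
by apply: ler_wpM2r; [exact: N0|exact: hW].
Qed.

(** The norm is first discretized in its own variable s, then the change of variable s = rho
    replaces the integers by the values of [ln rho]. *)
Lemma outer_norm_dyadic : exists2 D : R, 0 < D & forall f,
  (S f <= D%:E * lq r (fun i => (W i%:~R)%:E * Kfun X Y (rho i%:~R) f)%E)%E /\
  (lq r (fun i => (W i%:~R)%:E * Kfun X Y (rho i%:~R) f)%E <= D%:E * S f)%E.
Proof.
have hA := regvarM (regvar_expR (- theta)) ha.
have [C C0 hC] := regvar_growth hA.
(* [A] grows at most at rate [M], and the K-functional adds at most 1. *)
set M := `|_| + 1 in hC; have M0 : 0 <= M + 1 by rewrite !addr_ge0.
have [D1 D10 hD1] := lq_change_of_variable regvar_scale delta_gt0 r_gt0 C0 M0.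
have [D2 D20 hD2] := interp_norm_dyadic theta r_gt0 ha.
exists (D2 * D1) => [|f]; first exact: mulr_gt0.
have KXY : Kshape (fun x => Kfun X Y (expR x) f).
  by apply: Kfun_Kshape; [exact: norm_finite_interpR|exact: norm_finite_interp].
have [up low _ _] := hD2 (fun u => Kfun X Y u f) KXY.
pose phi x := ((A x)%:E * Kfun X Y (expR x) f)%E.
have Apos x : 0 < A x by exact: regvar_gt0 hA.
have [KXY0 KXY1] := KXY.
have phi0 x : (0 <= phi x)%E by rewrite mule_ge0// lee_fin ltW.
have growth x y : (Kfun X Y (expR y) f <= (expR `|y - x|)%:E * Kfun X Y (expR x) f)%E.
  have [xy|/ltW yx] := leP x y.
    by rewrite ger0_norm ?subr_ge0//; have [] := KXY1 _ _ xy.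
  have [h _] := KXY1 _ _ yx; apply: le_trans h _.
  by rewrite -[leLHS]mul1e lee_wpmul2r// lee_fin -expR0 ler_expR.
have phi1 x y : (phi y <= (C * expR ((M + 1) * `|y - x|))%:E * phi x)%E.
  rewrite /phi mulrDl mul1r expRD mulrA (EFinM _ (expR `|_|)) muleACA -EFinM.
  apply: lee_pmul => //; first by rewrite lee_fin ltW.
  by rewrite lee_fin; exact: hC.
have [h1 h2] := hD1 phi phi0 phi1.
have phiE i : phi (ln (rho i)) = ((W i)%:E * Kfun X Y (rho i) f)%E.
  by rewrite /phi lnK// posrE; exact: rho0.
have phiE' : (fun i : int => phi (ln (rho i%:~R))) =
    (fun i : int => ((W i%:~R)%:E * Kfun X Y (rho i%:~R) f)%E).
  by apply/funext => i; exact: phiE.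
rewrite -phiE'.
split.
  apply: le_trans up _; rewrite EFinM -muleA; apply: lee_wpmul2l; last exact: h1.
  by rewrite lee_fin ltW.
apply: le_trans h2 _; rewrite [D2 * D1]mulrC EFinM -muleA; apply: lee_wpmul2l; last exact: low.
by rewrite lee_fin ltW.
Qed.

Lemma Ktail_le_outer : exists2 D : R, 0 < D & forall f, sum_space X Y f ->
  (lqT f <= D%:E * S f)%E.
Proof.
have [C C0 hC] := Ktail_le_Kfun; have [D D0 hD] := outer_norm_dyadic.
exists (C * D) => [|f hf]; first exact: mulr_gt0.
have [_ low] := hD f; rewrite EFinM -muleA.
have KXY0 i : (0 <= Kfun X Y (rho i) f)%E.
  apply: Kfun_ge0; [exact: norm_finite_interpR|exact: norm_finite_interp|].
  exact: ltW (rho0 _).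
apply: (@le_trans _ _ (C%:E * lq r (fun i => (W i%:~R)%:E * Kfun X Y (rho i%:~R) f)%E)%E).
  rewrite -lqZ// => [|i]; last by rewrite mule_ge0// lee_fin ltW.
  apply: lq_le => // i; first by rewrite mule_ge0 ?Ktail_ge0// lee_fin ltW.
  rewrite EFinM -muleA [leRHS]muleCA; apply: lee_wpmul2l; first by rewrite lee_fin ltW.
  exact: hC.
by apply: lee_wpmul2l => //; rewrite lee_fin ltW.
Qed.

Let lq_term_fin (w : R) (x : \bar R) : 0 < w -> (w%:E * x < +oo)%E -> (x < +oo)%E.
Proof. by move=> w0; case: x => [x _|/=|//]; rewrite ?ltry// gt0_muley// lte_fin. Qed.

(** [Nsup] is the least admissible [M] in [Kfun_le_Ktail]. Its weighted norm is controlled by that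
    of [N], hence by [lqT]. Positive weights turn a finite norm into finite terms, as the pointwise
    estimate demands. *)
Lemma outer_le_Ktail : exists2 D : R, 0 < D & forall f, sumA f ->
  (lqT f < +oo)%E -> sum_space X Y f /\ (S f <= D%:E * lqT f)%E.
Proof.
have td0 : 0 < theta * (theta1 - theta0) by rewrite mulr_gt0.
(* [W] has index [- 4 * eps]: it decays at rate [2 * eps], and after the growth at rate [eps] in
   [Nsup] a rate [eps] is left for the Schur kernel. *)
pose eps := theta * (theta1 - theta0) / 4.
have eps0 : 0 < eps by rewrite divr_gt0.
have [C1 C10 hC1] : exists2 C, 0 < C & forall x y, x <= y ->
    W y <= C * expR (- (2 * eps) * (y - x)) * W x.
  by apply: (regvar_decay regvar_weight); rewrite /eps; lra.
pose P (j i : int) := (j <= i)%R.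
have [C2 C20 hC2] : exists2 D : R, 0 < D & forall f,
  (lq r (fun i => (W i%:~R)%:E * Nsup P eps f i)%E <=
    D%:E * lq r (fun i => (W i%:~R * N f i)%:E))%E.
  apply: (lq_Nsup eps0 C10) => [i|i j Pji]; first by rewrite /P.
  have ji : (j%:~R <= i%:~R :> R) by rewrite ler_int.
  apply: le_trans (ler_wpM2r (expR_ge0 _) (hC1 _ _ ji)) _.
  rewrite mulrAC -[X in X * _ <= _]mulrA -expRD ger0_norm ?subr_ge0//.
  have -> // : - (2 * eps) * (i%:~R - j%:~R) + eps * (i%:~R - j%:~R) =
    - eps * (i%:~R - j%:~R) :> R by ring.
have [C3 C30 hC3] := Kfun_le_Ktail eps0.
have [C4 C40 hC4] := lqD r_gt0.
have [D D0 hD] := outer_norm_dyadic.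
exists (D * (C3 * (C4 * (C2 + 1)))) => [|f hf Tfin].
  by rewrite !mulr_gt0// addr_gt0.
have T0 i : (0 <= (W i%:~R * rho i%:~R)%:E * Ktail f i)%E.
  by rewrite mule_ge0 ?Ktail_ge0// lee_fin ltW.
have Ns0 i : (0 <= Nsup P eps f i)%E by apply: Nsup_ge0; rewrite /P.
have WNs0 i : (0 <= (W i%:~R)%:E * Nsup P eps f i)%E.
  by rewrite mule_ge0// lee_fin ltW.
have Ns_le : (lq r (fun i => (W i%:~R)%:E * Nsup P eps f i)%E <= C2%:E * lqT f)%E.
  apply: le_trans (hC2 f) _; apply: lee_wpmul2l; last exact: lqN_le_lqT.
  by rewrite lee_fin ltW.
have Ktail_fin i : (Ktail f i < +oo)%E.
  apply: (lq_term_fin (Wrho0 i%:~R)); apply: le_lt_trans Tfin.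
  exact: (lq_ge_term i r_gt0 T0).
have Ns_fin i : (Nsup P eps f i < +oo)%E.
  apply: (lq_term_fin (W0 i%:~R)).
  apply: le_lt_trans (lq_ge_term i r_gt0 WNs0) _; apply: le_lt_trans Ns_le _.
  by rewrite lte_mul_pinfty// lee_fin ltW.
have hold i : sum_space X Y f /\ (Kfun X Y (rho i%:~R) f <=
    C3%:E * (Nsup P eps f i + (rho i%:~R)%:E * Ktail f i))%E.
  have NsE : Nsup P eps f i = (fine (Nsup P eps f i))%:E.
    by rewrite fineK// ge0_fin_numE.
  rewrite NsE; apply: hC3 => // [|j ji]; first by rewrite fine_ge0.
  have := @Nsup_ub P eps f i j ji; rewrite NsE lee_fin => h.
  have -> : expR (- theta0 * j%:~R) * c j%:~R * k j%:~R f =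
      expR (- eps * (i%:~R - j%:~R)) * (expR (eps * (i%:~R - j%:~R)) * N f j).
    by rewrite mulrA -expRD -mulrDl addNr mul0r expR0 mul1r.
  by apply: ler_wpM2l => //; exact: expR_ge0.
have [sXY _] := hold 0; split => //.
have [up _] := hD f; apply: le_trans up _.
rewrite EFinM -muleA; apply: lee_wpmul2l; first by rewrite lee_fin ltW.
have KXY0 i : (0 <= Kfun X Y (rho i) f)%E.
  apply: Kfun_ge0; [exact: norm_finite_interpR|exact: norm_finite_interp|].
  exact: ltW (rho0 _).
apply: (@le_trans _ _ (lq r (fun i => C3%:E * ((W i%:~R)%:E * Nsup P eps f i +
    (W i%:~R * rho i%:~R)%:E * Ktail f i))%E)).
  apply: lq_le => // i; first by rewrite mule_ge0// lee_fin ltW.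
  rewrite (EFinM (W _) (rho _)) -[X in (_ <= _ * (_ + X))%E]muleA -ge0_muleDr//; last first.
    by rewrite mule_ge0 ?Ktail_ge0// lee_fin; exact: ltW (rho0 _).
  rewrite [leRHS]muleCA; apply: lee_wpmul2l; first by rewrite lee_fin ltW.
  by have [] := hold i.
rewrite lqZ// => [|i]; last by rewrite adde_ge0.
rewrite [X in (_ <= X * _)%E]EFinM -muleA; apply: lee_wpmul2l; first by rewrite lee_fin ltW.
apply: le_trans (hC4 _ _ WNs0 T0) _.
rewrite [X in (_ <= X * _)%E]EFinM -muleA; apply: lee_wpmul2l; first by rewrite lee_fin ltW.
have lqT0 : (0 <= lqT f)%E by apply: lq_ge0.
rewrite EFinD ge0_muleDl ?lee_fin ?(ltW C20)// mul1e; exact: leeD.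
Qed.

(** To the right of [i], [N] is at most [Nsup] times growth at rate [eps]. As 1/rho decays faster,
    the tail of N/rho is at most a multiple of [Nsup] divided by [rho i]; as [W] decays more slowly,
    [Nsup] is absorbed by [N]. *)
Lemma Ktail_le_weighted : theta < 1 -> exists2 D : R, 0 < D & forall f, sumA f ->
  (lqT f <= D%:E * lq r (fun i => (W i%:~R * N f i)%:E))%E.
Proof.
move=> theta_lt1; pose d := theta1 - theta0; have d0 : 0 < d := delta_gt0.
have gap : 0 < (1 - theta) * d by rewrite mulr_gt0// subr_gt0.
(* The interval from [theta * d] to [d] is cut into four parts of length [eta], with [eps] in the
   middle: margin for the slow variation of [W] on one side and of [rho] on the other. *)
pose eta := (1 - theta) * d / 4; have eta0 : 0 < eta by rewrite divr_gt0.
pose eps := theta * d + 2 * eta.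
have epsd : eps + eta < d by rewrite /eps /eta; lra.
have [C1 C10 hC1] : exists2 C, 0 < C & forall x y, y <= x ->
    W y <= C * expR (- (- (theta * d + eta)) * (x - y)) * W x.
  apply: (regvar_incr regvar_weight); rewrite -/d ltrN2; lra.
pose P (j i : int) := (i <= j)%R.
have [C2 C20 hC2] : exists2 D : R, 0 < D & forall f,
  (lq r (fun i => (W i%:~R)%:E * Nsup P eps f i)%E <=
    D%:E * lq r (fun i => (W i%:~R * N f i)%:E))%E.
  apply: (lq_Nsup eta0 C10) => [i|i j Pji]; first by rewrite /P.
  have ij : (i%:~R <= j%:~R :> R) by rewrite ler_int.
  apply: le_trans (ler_wpM2r (expR_ge0 _) (hC1 _ _ ij)) _.
  rewrite mulrAC -[X in X * _ <= _]mulrA -expRD distrC ger0_norm ?subr_ge0//.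
  have -> // : - (- (theta * d + eta)) * (j%:~R - i%:~R) + eps * (i%:~R - j%:~R) =
    - eta * (j%:~R - i%:~R) :> R by rewrite /eps; ring.
have [C3 C30 hC3] : exists2 C, 0 < C & forall x y, x <= y ->
    (rho y)^-1 <= C * expR (- (eps + eta) * (y - x)) * (rho x)^-1.
  by apply: (regvar_decay (regvarV regvar_scale)); rewrite ltrN2.
have [C4 C40 hC4] := lq_bump r1_gt0 eta0.
exists (C4 * C3 * C2) => [|f hf]; first by rewrite !mulr_gt0.
have Ns0 i : (0 <= Nsup P eps f i)%E by apply: Nsup_ge0; rewrite /P.
rewrite EFinM -muleA; apply: (@le_trans _ _ ((C4 * C3)%:E *
    lq r (fun i => (W i%:~R)%:E * Nsup P eps f i)%E)%E); last first.
  by apply: lee_wpmul2l => //; rewrite lee_fin mulr_ge0// ltW.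
rewrite -lqZ ?mulr_gt0// => [|i]; last by rewrite mule_ge0// lee_fin ltW.
apply: lq_le => // i; first by rewrite mule_ge0 ?Ktail_ge0// lee_fin ltW.
have ri0 := rho0 i%:~R.
have bump : (Ktail f i <= C4%:E * ((C3 * (rho i%:~R)^-1)%:E * Nsup P eps f i))%E.
  apply: hC4; first by apply: tail_ge0; exact: weighted_ge0 hb1 (KfunA_Kshape f).
    by rewrite mule_ge0// lee_fin mulr_ge0 ?invr_ge0// ltW.
  move=> j; have E0 : (0 <= (expR (- eta * `|j%:~R - i%:~R|))%:E :> \bar R)%E.
    by rewrite lee_fin expR_ge0.
  rewrite /tail; case: ifPn => ij; last first.
    by rewrite !mule_ge0// lee_fin mulr_ge0 ?invr_ge0// ltW.
  have ijR : (i%:~R <= j%:~R :> R) by rewrite ler_int.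
  rewrite weightedE//; have rj0 := rho0 j%:~R.
  have -> : expR (- theta1 * j%:~R) * b1 (expR j%:~R) * k j%:~R f = (rho j%:~R)^-1 * N f j.
    by rewrite -scaleN mulKf ?gt_eqF.
  apply: (@le_trans _ _ ((expR (- eta * `|j%:~R - i%:~R|))%:E *
      ((C3 * (rho i%:~R)^-1)%:E * (expR (eps * (i%:~R - j%:~R)) * N f j)%:E))%E).
    rewrite -!EFinM lee_fin.
    have -> : expR (- eta * `|j%:~R - i%:~R|) *
        (C3 * (rho i%:~R)^-1 * (expR (eps * (i%:~R - j%:~R)) * N f j)) =
        C3 * (expR (- eta * `|j%:~R - i%:~R|) * expR (eps * (i%:~R - j%:~R))) *
        (rho i%:~R)^-1 * N f j by ring.
    rewrite ler_wpM2r// -expRD ger0_norm ?subr_ge0//.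
    have -> : - eta * (j%:~R - i%:~R) + eps * (i%:~R - j%:~R) =
      - (eps + eta) * (j%:~R - i%:~R) :> R by ring.
    exact: hC3.
  apply: lee_wpmul2l => //; apply: lee_wpmul2l.
    by rewrite lee_fin mulr_ge0 ?invr_ge0// ltW.
  exact: Nsup_ub.
apply: le_trans (lee_wpmul2l _ bump) _; first by rewrite lee_fin ltW.
rewrite !muleA -!EFinM; apply: lee_wpmul2r => //.
rewrite lee_fin le_eqVlt; apply/orP; left; apply/eqP.
by field; rewrite gt_eqF.
Qed.

(** * Identification of the resulting spaces *)

Let rhoE x : rho x = expR ((theta1 - theta0) * x + ln (c x) - ln (ga x)).
Proof.
by rewrite /rho expRD expRD expRN !lnK ?posrE ?mulrA//; exact: c_gt0.
Qed.

Let lnrhoK x : expR (ln (rho x)) = rho x.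
Proof. by apply: lnK; rewrite posrE; exact: rho0. Qed.

Let a_rho : regvar (fun x => a (rho x)) 0.
Proof.
have := regvar_comp ha regvar_scale; congr regvar; apply/funext => x.
by rewrite lnrhoK.
Qed.

(** The parameters of the target space are exactly those for which its discrete weight equals [W]
    times that of [N]; the rest is the chain between [N], [lqT] and the outer norm. *)
Lemma reiteration_lt1 (ash : R -> R) : theta < 1 ->
  (forall x, ash (expR x) = c x `^ (1 - theta) * ga x `^ theta * a (rho x)) ->
  cong_space (interp X Y theta r a)
    (interp A0 A1 ((1 - theta) * theta0 + theta * theta1) r ash).
Proof.
move=> theta_lt1 ashE; set eta := _ + _.
have hash : regvar (fun x => ash (expR x)) 0.
  have hc : regvar c 0 by have := regvarM ha0 hB; rewrite addr0.
  have t1 : 0 < 1 - theta by rewrite subr_gt0.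
  have := regvarM (regvarM (regvar_powR t1 hc) (regvar_powR theta_gt0 hb1)) a_rho.
  by rewrite !mulr0 !addr0; congr regvar; apply/funext.
(* After taking logarithms the identity is linear in x, ln c and ln b1; the coefficient of x is
   [- eta]. *)
have wE f : sumA f -> weighted eta ash (K f) = (fun i => (W i%:~R * N f i)%:E).
  move=> hf; apply/funext => j; rewrite weightedE// ashE /W /A /N lnrhoK.
  set x : R := j%:~R; congr (_%:E).
  have cE : c x = expR (ln (c x)) by rewrite lnK// posrE; exact: c_gt0.
  have gE : ga x = expR (ln (ga x)) by rewrite lnK// posrE; exact: ga0.
  have c_pow : c x `^ (1 - theta) = expR ((1 - theta) * ln (c x)).
    by rewrite {1}cE powR_expR.
  have g_pow : ga x `^ theta = expR (theta * ln (ga x)).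
    by rewrite {1}gE powR_expR.
  have ln_rho : ln (rho x) = (theta1 - theta0) * x + ln (c x) - ln (ga x).
    by rewrite rhoE expRK.
  rewrite c_pow g_pow [in RHS]cE ln_rho.
  move: (ln (c x)) (ln (ga x)) (a (rho x)) (k x f) => lc lg ar kk.
  transitivity (expR (- eta * x + (1 - theta) * lc + theta * lg) * (ar * kk)).
    by rewrite !expRD; ring.
  transitivity (expR (- theta * ((theta1 - theta0) * x + lc - lg) +
    (- theta0 * x + lc)) * (ar * kk)).
    by congr (expR _ * _); rewrite /eta; ring.
  by rewrite expRD (expRD (- theta0 * x)); ring.
have [C C0 hC] := interp_norm_dyadic eta r_gt0 hash.
have [D1 D10 hD1] := Ktail_le_outer; have [D2 D20 hD2] := outer_le_Ktail.
have [D3 D30 hD3] := Ktail_le_weighted theta_lt1.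
have S0 f : (0 <= S f)%E by exact: Lnorm_ge0.
have T0 f : (0 <= interp_norm A0 A1 eta r ash f)%E by exact: Lnorm_ge0.
have up f : sum_space X Y f ->
    (interp_norm A0 A1 eta r ash f <= (C * D1)%:E * S f)%E.
  move=> sf; have hf := sum_space_endpoints sf.
  have [h _ _ _] := hC (K f) (KfunA_Kshape f); rewrite wE// in h.
  apply: le_trans h _; rewrite EFinM -muleA; apply: lee_wpmul2l.
    by rewrite lee_fin ltW.
  exact: le_trans (lqN_le_lqT hf) (hD1 f sf).
have low f : sumA f -> (lqT f <= (D3 * C)%:E * interp_norm A0 A1 eta r ash f)%E.
  move=> hf; apply: le_trans (hD3 f hf) _; rewrite EFinM -muleA.
  apply: lee_wpmul2l; first by rewrite lee_fin ltW.
  by have [_ h _ _] := hC (K f) (KfunA_Kshape f); rewrite wE// in h.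
split; split.
- move=> f [sf Sfin]; split; first exact: sum_space_endpoints sf.
  apply: le_lt_trans (up f sf) _.
  by rewrite lte_mul_pinfty// lee_fin mulr_ge0// ltW.
- by exists (C * D1) => [|f [sf _]]; [exact: mulr_gt0|exact: up].
- move=> f [hf Tfin]; have lfin : (lqT f < +oo)%E.
    apply: le_lt_trans (low f hf) _.
    by rewrite lte_mul_pinfty// lee_fin mulr_ge0// ltW.
  have [sXY h] := hD2 f hf lfin; split => //; apply: le_lt_trans h _.
  by rewrite lte_mul_pinfty// lee_fin ltW.
- exists (D2 * (D3 * C)) => [|f [hf Tfin]]; first by rewrite !mulr_gt0.
  have lfin : (lqT f < +oo)%E.
    apply: le_lt_trans (low f hf) _.
    by rewrite lte_mul_pinfty// lee_fin mulr_ge0// ltW.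
  have [_ h] := hD2 f hf lfin; apply: le_trans h _.
  rewrite EFinM -muleA; apply: lee_wpmul2l (low f hf).
  by rewrite lee_fin ltW.
Qed.

(** At [theta = 1] the powers of rho in [W * rho] cancel and leave a(rho) = [ash / b1]. Thus [lqT]
    is itself the discrete norm of the target space, and it is compared directly with the outer
    norm. *)
Lemma reiteration_eq1 (ash : R -> R) : theta = 1 ->
  (forall x, ash (expR x) = ga x * a (rho x)) ->
  cong_space (interp X Y theta r a) (interpR A0 A1 theta1 r ash r1 b1).
Proof.
move=> theta1E ashE.
have hash : regvar (fun x => ash (expR x)) 0.
  have := regvarM hb1 a_rho.
  by rewrite addr0; congr regvar; apply/funext.
have ratioE x : ash (expR x) / b1 (expR x) = W x * rho x.
  rewrite ashE /W /A lnrhoK theta1E mulN1r expRN lnrhoK.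
  rewrite -[b1 (expR x)]/(ga x); have := rho0 x; move: (rho x) => rx rx0.
  by field; rewrite !gt_eqF.
have [C C0 hC] := interpR_norm_dyadic theta1 r1_gt0 r_gt0 hb1 hash.
have vE f : (fun i : int => (ash (expR i%:~R) / b1 (expR i%:~R))%:E *
    lq r1 (tail i (weighted theta1 b1 (K f))))%E =
    (fun i => (W i%:~R * rho i%:~R)%:E * Ktail f i)%E.
  by apply/funext => i; rewrite ratioE.
have [D1 D10 hD1] := Ktail_le_outer; have [D2 D20 hD2] := outer_le_Ktail.
have S0 f : (0 <= S f)%E by exact: Lnorm_ge0.
have T0 f : (0 <= interpR_norm A0 A1 theta1 r ash r1 b1 f)%E by exact: Lnorm_ge0.
have norm_le f : (interpR_norm A0 A1 theta1 r ash r1 b1 f <= C%:E * lqT f)%E.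
  by have [h _] := hC (K f) (KfunA_Kshape f); rewrite vE in h.
have norm_ge f : (lqT f <= C%:E * interpR_norm A0 A1 theta1 r ash r1 b1 f)%E.
  by have [_ h] := hC (K f) (KfunA_Kshape f); rewrite vE in h.
have up f : sum_space X Y f ->
    (interpR_norm A0 A1 theta1 r ash r1 b1 f <= (C * D1)%:E * S f)%E.
  move=> sf; apply: le_trans (norm_le f) _; rewrite EFinM -muleA.
  by apply: lee_wpmul2l (hD1 f sf); rewrite lee_fin ltW.
split; split.
- move=> f [sf Sfin]; split; first exact: sum_space_endpoints sf.
  apply: le_lt_trans (up f sf) _.
  by rewrite lte_mul_pinfty// lee_fin mulr_ge0// ltW.
- by exists (C * D1) => [|f [sf _]]; [exact: mulr_gt0|exact: up].
- move=> f [hf Tfin]; have lfin : (lqT f < +oo)%E.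
    by apply: le_lt_trans (norm_ge f) _; rewrite lte_mul_pinfty// lee_fin ltW.
  have [sXY h] := hD2 f hf lfin; split => //; apply: le_lt_trans h _.
  by rewrite lte_mul_pinfty// lee_fin ltW.
- exists (D2 * C) => [|f [hf Tfin]]; first exact: mulr_gt0.
  have lfin : (lqT f < +oo)%E.
    by apply: le_lt_trans (norm_ge f) _; rewrite lte_mul_pinfty// lee_fin ltW.
  have [_ h] := hD2 f hf lfin; apply: le_trans h _.
  rewrite EFinM -muleA; apply: lee_wpmul2l (norm_ge f).
  by rewrite lee_fin ltW.
Qed.

End Holmstedt.

Theorem theorem24 (R : realType) (V : topologicalLmodType R)
    (A0 A1 : qspace V)
    (hA : compatible_couple A0 A1)
    (hA01 : carrier A0 `&` carrier A1 <> [set 0])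
    (theta0 theta1 : R) (q0 r r1 r0 : \bar R) (a a0 b0 b1 : R -> R)
    (htheta0 : 0 < theta0) (htheta01 : theta0 < theta1) (htheta1 : theta1 < 1)
    (hq0 : (0 < q0)%E) (hr : (0 < r)%E) (hr1 : (0 < r1)%E) (hr0 : (0 < r0)%E)
    (ha : SV a) (ha0 : SV a0) (hb0 : SV b0) (hb1 : SV b1)
    (hfin : (Lq r0 `]0%R, 1%R[ (fun s => (s `^ (- rcp r0) * (b0 s / a0 s))%:E)
             < +oo)%E) :
  let c0 := fun t : R =>
    a0 t * fine (Lq r0 `]0, t[
                   (fun s => (s `^ (- rcp r0) * (b0 s / a0 s))%:E)) in
  let rho := fun t : R => t `^ (theta1 - theta0) * (c0 t / b1 t) in
  (forall theta : R, 0 < theta -> theta < 1 ->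
     let eta := (1 - theta) * theta0 + theta * theta1 in
     let ash := fun t : R => c0 t `^ (1 - theta) * b1 t `^ theta * a (rho t) in
     cong_space
       (interp (interpR A0 A1 theta0 r0 b0 q0 a0) (interp A0 A1 theta1 r1 b1)
               theta r a)
       (interp A0 A1 eta r ash))
  /\
  ((Lq r `]0%R, 1%R[ (fun s => (s `^ (- rcp r) * a s)%:E) < +oo)%E ->
     let ash := fun t : R => b1 t * a (rho t) in
     cong_space
       (interp (interpR A0 A1 theta0 r0 b0 q0 a0) (interp A0 A1 theta1 r1 b1)
               1 r a)
       (interpR A0 A1 theta1 r ash r1 b1)).
Proof.
move=> c0 rho; have [_ [[qA0 _] [qA1 _]] _] := hA.
have [wa wa0] := (SV_regvar ha, SV_regvar ha0).
have [wb0 wb1] := (SV_regvar hb0, SV_regvar hb1).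
have wbe : regvar (fun x => b0 (expR x) / a0 (expR x)) 0.
  by have := regvarM wb0 (regvarV wa0); rewrite oppr0 addr0.
(* Finiteness near 0 makes the [fine] value in [c0] a genuine norm for every t, positive and slowly
   varying. *)
have [wB B_initial] := regvar_initial_norm (be := fun t => b0 t / a0 t) hr0 wbe hfin.
have theta1_gt0 := lt_trans htheta0 htheta01.
split=> [theta theta_gt0 theta_lt1|_]; move=> /=.
  apply: (reiteration_lt1 (B := fun x => fine (Lq r0 `]0, expR x[
    (fun s => (s `^ (- rcp r0) * (b0 s / a0 s))%:E)))) => //.
  by move=> x; rewrite /rho powR_expR.
apply: (reiteration_eq1 (B := fun x => fine (Lq r0 `]0, expR x[
  (fun s => (s `^ (- rcp r0) * (b0 s / a0 s))%:E)))) => //.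
by move=> x; rewrite /rho powR_expR.
Qed.
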